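(* Let $K$ be a field, let $G$ be a finite connected simple graph and let $G_1,\ldots,G_s$ be the $2$-connected components of $G$. Then the edge ring $K[G]$ is strongly Koszul if and only if, after a permutation of the indices, $G_1,\ldots,G_{s-1}$ are complete bipartite graphs and $G_s$ is of one of the following types: (i) a complete bipartite graph; (ii) an almost bipartite graph (with $v$ a vertex of $G_s$ contained in every odd cycle of $G_s$) such that each $2$-connected component of the bipartite graph $G_s(v,V_1,V_2)$ is complete bipartite, where $V_1\cup V_2$ is a bipartition of the vertex set of the bipartite graph $(G_s)_{V(G_s)\setminus\{v\}}$; (iii) the complete graph $K_4$.
   Context: A finite graph is simple if it has no loops or multiple edges. For a graph $G$ on the vertex set $[n]=\{1,\ldots,n\}$ with edge set $E(G)=\{e_1,\ldots,e_d\}$, put $X^e=X_iX_j\in K[X_1,\ldots,X_n]$ for $e=\{i,j\}$; the edge ring of $G$ is the subring $K[G]=K[X^{e_1},\ldots,X^{e_d}]$, graded so that each $X^{e_i}$ has degree $1$. A graded $K$-algebra $R$ with homogeneous maximal ideal $\mathfrak{m}=R_+$ is strongly Koszul if $\mathfrak{m}$ has a minimal system of homogeneous generators $\{u_1,\ldots,u_t\}$ such that for all subsequences $u_{i_1},\ldots,u_{i_r}$ with $i_1<\cdots<i_r$ and for all $j=1,\ldots,r$, the colon ideal $(u_{i_1},\ldots,u_{i_{j-1}}):u_{i_j}$ is generated by a subset of $\{u_1,\ldots,u_t\}$. $G_W$ denotes the induced subgraph of $G$ on the vertex set $W$. A connected simple graph $G$ is $2$-connected if $G_{V(G)\setminus\{v\}}$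 is also connected for every vertex $v$ (so a single edge is $2$-connected). The $2$-connected components of a graph are its maximal $2$-connected subgraphs. A cycle is a closed walk $(\{v_1,v_2\},\{v_2,v_3\},\ldots,\{v_q,v_1\})$ with $q\ge 3$ and $v_1,\ldots,v_q$ distinct; it is odd if $q$ is odd. A graph $G$ is almost bipartite if there exists a vertex $v$ such that every odd cycle of $G$ contains $v$; then $G_{V(G)\setminus\{v\}}$ is bipartite. For a bipartition $V_1\cup V_2$ of $G_{V(G)\setminus\{v\}}$, $G(v,V_1,V_2)$ is the bipartite graph on the vertex set $V(G)\cup\{v'\}$, where $v'\notin V(G)$ is a new vertex, with edge set $$E(G_{V(G)\setminus\{v\}})\cup\{\{i,v\}\in E(G) : i\in V_1\}\cup\{\{i,v'\} : i\in V_2,\ \{i,v\}\in E(G)\}.$$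
   Formalization: Strong Koszulness of K[G] is taken with respect to a minimal system of generators consisting of monomials; with arbitrary homogeneous generators the ''only if'' direction fails, e.g. for two 4-cycles sharing an edge over an infinite field. *)

(* Defs.v *)
From HB Require Import structures.
From mathcomp Require Import all_boot all_order all_algebra.
From mathcomp Require Import boolp.
From mathcomp Require Import mpoly.

Set Implicit Arguments.
Unset Strict Implicit.
Unset Printing Implicit Defensive.

Import GRing.Theory.
Local Open Scope ring_scope.

Section Graphs.
Variable V : finType.

Record sgraph := SGraph {
  vset : {set V};
  eset : {set {set V}};
  esetP : [forall e in eset, (e \subset vset) && (#|e| == 2%N)] }.

Definition adj (G : sgraph) : rel V := fun x y => [set x; y] \in eset G.

(* Edges only join vertices of [vset G], so paths cannot leave [vset G].  The
   empty graph counts as connected; hence a one-vertex graph is 2-connected, and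
   an isolated vertex is a 2-connected component. *)
Definition connected (G : sgraph) : Prop :=
  {in vset G &, forall x y, connect (adj G) x y}.

Lemma induced_subproof (G : sgraph) (W : {set V}) :
  [forall e in [set e in eset G | e \subset vset G :&: W],
     (e \subset vset G :&: W) && (#|e| == 2%N)].
Proof.
apply/forall_inP => e; rewrite inE => /andP[eG ->] /=.
by have /forall_inP/(_ e eG)/andP[] := esetP G.
Qed.

Definition induced (G : sgraph) (W : {set V}) : sgraph :=
  SGraph (induced_subproof G W).

Definition delv (G : sgraph) (v : V) : sgraph := induced G (vset G :\ v).

Definition two_connected (G : sgraph) : Prop :=
  connected G /\ {in vset G, forall v, connected (delv G v)}.

Definition subgraph (H G : sgraph) : Prop :=
  (vset H \subset vset G) && (eset H \subset eset G).

Definition two_connected_component (G H : sgraph) : Prop :=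
  [/\ subgraph H G, two_connected H &
      forall H', subgraph H' G -> two_connected H' -> subgraph H H' -> H' = H].

Definition bipartition (G : sgraph) (V1 V2 : {set V}) : Prop :=
  [/\ V1 :|: V2 = vset G, [disjoint V1 & V2] &
      {in eset G, forall e : {set V},
         exists x y, [/\ x \in V1, y \in V2 & e = [set x; y]]}].

(* A part may be empty: for a connected graph this only adds the one-vertex
   graph K_{1,0}. *)
Definition complete_bipartite (G : sgraph) : Prop :=
  exists V1 V2 : {set V},
    bipartition G V1 V2 /\ {in V1 & V2, forall x y, adj G x y}.

Definition odd_cycle (G : sgraph) (c : seq V) : Prop :=
  [/\ (3 <= size c)%N, odd (size c) & ucycle (adj G) c].

Definition meets_odd_cycles (G : sgraph) (v : V) : Prop :=
  v \in vset G /\ (forall c, odd_cycle G c -> v \in c).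

Definition is_K4 (G : sgraph) : Prop :=
  #|vset G| = 4%N /\ {in vset G &, forall x y, x != y -> adj G x y}.

End Graphs.

Section Split.
Variables (V : finType) (G : sgraph V) (v : V) (V1 V2 : {set V}).

(* [G(v, V1, V2)]: a vertex [x] of [G] becomes [Some x], and [None] is the new
   vertex [v']. *)
Definition split_vset : {set option V} := None |: [set Some x | x in vset G].

Definition split_eset : {set {set option V}} :=
  [set [set Some x | x in e : {set V}] | e in eset (delv G v)]
  :|: [set [set Some i; Some v] | i in V1 & adj G i v]
  :|: [set [set Some i; None] | i in V2 & adj G i v].

Lemma split_subproof :
  [forall e in split_eset, (e \subset split_vset) && (#|e| == 2%N)].
Proof.
have EP e : e \in eset G -> e \subset vset G /\ #|e| = 2%N.
  by move=> eG; have /forall_inP/(_ e eG)/andP[? /eqP] := esetP G.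
apply/forall_inP => f; rewrite !inE => /orP[/orP[]|] /imsetP[].
- move=> e; rewrite inE => /andP[/EP[sub c2] _] ->.
  rewrite card_imset ?c2 ?eqxx ?andbT; last exact: Some_inj.
  by rewrite subsetU // imsetS ?orbT.
- move=> i; rewrite inE => /andP[_ /EP[sub c2]] ->; apply/andP; split.
    apply/subsetP => x; rewrite !inE => /orP[]/eqP->; rewrite imset_f //;
      by apply: (subsetP sub); rewrite !inE eqxx ?orbT.
  by move: c2; rewrite !cards2 (inj_eq Some_inj) => ->.
- move=> i; rewrite inE => /andP[_ /EP[sub c2]] ->; apply/andP; split.
    apply/subsetP => x; rewrite !inE => /orP[]/eqP->; rewrite ?eqxx //.
    by rewrite imset_f //; apply: (subsetP sub); rewrite !inE eqxx.
  by rewrite cards2.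
Qed.

Definition split_graph : sgraph (option V) := SGraph split_subproof.

End Split.

Definition split_type (V : finType) (G : sgraph V) : Prop :=
  exists (v : V) (V1 V2 : {set V}),
    [/\ meets_odd_cycles G v, bipartition (delv G v) V1 V2 &
        forall H, two_connected_component (split_graph G v V1 V2) H ->
          complete_bipartite H].

Section StronglyKoszul.
Variables (R : comNzRingType) (gr : nat -> R -> Prop).

(* [gr k] is the homogeneous component of degree [k]; [irrelevant] is the ideal
   [R_+]. *)
Definition homogeneous (x : R) : Prop := exists k, gr k x.

Definition irrelevant (x : R) : Prop :=
  exists d (f : 'I_d -> R),
    (forall k : 'I_d, gr k.+1 (f k)) /\ x = \sum_(k < d) f k.

Definition ideal_gen t (u : 'I_t -> R) (A : {set 'I_t}) (x : R) : Prop :=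
  exists a : 'I_t -> R, x = \sum_(k in A) a k * u k.

Definition minimal_homogeneous_generators t (u : 'I_t -> R) : Prop :=
  [/\ forall k, homogeneous (u k),
      forall x, ideal_gen u setT x <-> irrelevant x &
      forall A : {set 'I_t},
        (forall x, ideal_gen u A x <-> irrelevant x) -> A = setT].

(* The colon ideal [I : y] is [{x | x * y \in I}]. *)
Definition strongly_koszul_with t (u : 'I_t -> R) : Prop :=
  minimal_homogeneous_generators u /\
  forall r (i : 'I_r -> 'I_t), {homo i : a b / (a < b)%N} ->
  forall j : 'I_r, exists A : {set 'I_t}, forall x,
    ideal_gen u [set i k | k : 'I_r & (k < j)%N] (x * u (i j))
    <-> ideal_gen u A x.

Definition strongly_koszul : Prop :=
  exists t (u : 'I_t -> R), strongly_koszul_with u.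

End StronglyKoszul.

Section EdgeRing.
Variables (K : fieldType) (n : nat) (G : sgraph 'I_n).

Definition edge_monomials : #|eset G|.-tuple {mpoly K[n]} :=
  [tuple \prod_(i in enum_val k) 'X_i | k < #|eset G|].

Definition edge_ring_pred : {pred {mpoly K[n]}} :=
  fun p => `[< exists q : {mpoly K[#|eset G|]}, p = q \mPo edge_monomials >].

Lemma edge_ring_subalg : subalg_closed edge_ring_pred.
Proof.
split.
- by apply/asboolP; exists 1; rewrite comp_mpoly1.
- move=> a p q /asboolP[p' ->] /asboolP[q' ->]; apply/asboolP.
  by exists (a *: p' + q'); rewrite comp_mpolyD comp_mpolyZ.
- move=> p q /asboolP[p' ->] /asboolP[q' ->]; apply/asboolP.
  by exists (p' * q'); rewrite rmorphM.
Qed.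

HB.instance Definition _ :=
  GRing.isSubalgClosed.Build K {mpoly K[n]} edge_ring_pred edge_ring_subalg.

Record edge_ring := EdgeRing {
  edge_ring_val :> {mpoly K[n]};
  _ : edge_ring_val \in edge_ring_pred }.

HB.instance Definition _ := [isSub for edge_ring_val].
HB.instance Definition _ := [Choice of edge_ring by <:].
HB.instance Definition _ := [SubChoice_isSubComNzRing of edge_ring by <:].
HB.instance Definition _ := [SubZmodule_isSubLmodule of edge_ring by <:].
HB.instance Definition _ :=
  [SubNzRing_SubLmodule_isSubLalgebra of edge_ring by <:].
HB.instance Definition _ := [SubLalgebra_isSubAlgebra of edge_ring by <:].

Definition edge_grading (k : nat) (p : edge_ring) : Prop :=
  exists2 q : {mpoly K[#|eset G|]},
    q \is k.-homog & val p = q \mPo edge_monomials.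

Definition is_monomial (p : edge_ring) : Prop :=
  exists m : 'X_{1..n}, val p = 'X_[m].

(* Strong Koszulness depends on the system of generators that one allows.  For a
   toric ring such as [K[G]] the system is made of the monomials generating it;
   its order is left free.  If arbitrary linear forms were admitted, the notion
   would no longer be combinatorial: over the rationals, the two squares glued
   along an edge, whose edge ring is K[a,b,c,d,f,g,z]/(ab-cz, df-gz), would be
   [strongly_koszul], although this 2-connected bipartite graph is not complete
   bipartite. *)
Definition edge_ring_strongly_koszul : Prop :=
  exists t (u : 'I_t -> edge_ring),
    (forall k, is_monomial (u k)) /\ strongly_koszul_with edge_grading u.

Lemma edge_ring_strongly_koszulW :
  edge_ring_strongly_koszul -> strongly_koszul edge_grading.
Proof. by move=> [t [u [_ uP]]]; exists t, u. Qed.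

End EdgeRing.

(* Main.v *)
Require Import Defs.
From mathcomp Require Import all_boot all_order all_algebra.
From mathcomp Require Import boolp zify.
From mathcomp Require mpoly.

(** Monomials of K[G] are products of edges, so strong Koszulness for the edges
    is a statement about multisets of edges: for two edges e <> f, the colon
    ideal (e) : f has to be generated by edges, i.e. whenever a product ms of
    edges satisfies ms * f = e * ns, some edge g dividing ms satisfies
    g * f = e * h for an edge h.  Call this the exchange property.  Longer colon
    ideals are sums of colon ideals of this kind, because the ideals are spanned
    by monomials ([exchange_strongly_koszul], [strongly_koszul_exchange]).

    A graph with the exchange property is very rigid.  If e and f are disjoint
    then g = e, so a vertex weight w with w + e and w + f products of edges is
    itself a product of edges.  Applied along walks this says
    ([two_odd_walks_adj]): if two walks of odd length from x to y have disjoint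
    interiors, then x and y are adjacent; in particular there are no two odd
    closed walks at x with disjoint interiors.  Consequences:
    - in a 2-connected bipartite graph every walk of length 3 has adjacent
      ends, hence the graph is complete bipartite
      ([two_connected_complete_bipartite]);
    - two non-bipartite blocks contain odd closed walks which can be moved to a
      common base point with disjoint interiors, so at most one block is
      non-bipartite ([odd_blocks_eq]);
    - let c be a shortest odd cycle of a 2-connected non-bipartite graph.  If
      deleting the vertex c_0 leaves an odd closed walk, then c_0 has a twin off
      the cycle with the same two neighbours on it ([twin]).  When both c_0 and
      c_1 have twins, a cycle of length at least 5 acquires a chord, which is
      absurd, and a triangle extends to K4 ([two_twins_clique4]), which then is
      the whole block ([clique4_is_K4]).  Otherwise a vertex v meets all odd
      cycles.  Splitting v makes the graph bipartite without changing the edge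
      ring ([split_iso]), so the bipartite case applies to the split graph.

    Conversely, the exchange property holds for complete bipartite graphs and
    for K4 by inspection.  It passes from blocks to the whole graph as soon as
    at most one block is non-bipartite: at a cut vertex, the degrees of a
    product of edges on a bipartite side determine its degree at the cut vertex,
    so the edge ring is a tensor product ([separation_independent_edges],
    [exchange_of_blocks]).  This settles split graphs whose blocks are complete
    bipartite, hence blocks of the second type, and finally G. *)

Set Implicit Arguments.
Unset Strict Implicit.
Unset Printing Implicit Defensive.

(** * Edge lists and the exchange property *)

Section Exchange.
Variable V : finType.
Implicit Types (G H : sgraph V) (e f g h : {set V}) (ms ns es : seq {set V}).
Implicit Types (x y z : V).

Lemma edge_sub G e : e \in eset G -> e \subset vset G.
Proof. by move=> eG; have /forall_inP/(_ e eG)/andP[] := esetP G. Qed.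

Lemma edge_card G e : e \in eset G -> #|e| = 2.
Proof. by move=> eG; have /forall_inP/(_ e eG)/andP[_ /eqP] := esetP G. Qed.

Lemma edgeP G e : e \in eset G -> exists x y, [/\ x != y, e = [set x; y] & adj G x y].
Proof.
move=> eG; have /eqP/cards2P[x [y [xy e_xy]]] := edge_card eG.
by exists x, y; split; rewrite // /adj -e_xy.
Qed.

Lemma edge_at G e x : e \in eset G -> x \in e ->
  exists y, [/\ x != y, e = [set x; y] & adj G x y].
Proof.
move=> eG; have [a [b [ab -> adjab]]] := edgeP eG.
rewrite !inE => /orP[]/eqP->; [exists b | exists a] => //; split; rewrite // 1?eq_sym //.
- by rewrite setUC.
- by rewrite /adj setUC.
Qed.

Lemma adj_sym G : symmetric (adj G).
Proof. by move=> x y; rewrite /adj setUC. Qed.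

Lemma adj_irr G x : adj G x x = false.
Proof. by apply/negP => /edge_card; rewrite setUid cards1. Qed.

Lemma adj_neq G x y : adj G x y -> x != y.
Proof. by apply: contraL => /eqP->; rewrite adj_irr. Qed.

Lemma in_set2_nat x y z : x != y -> (z \in [set x; y]) = (z == x) + (z == y) :> nat.
Proof.
by rewrite !inE; case: (eqVneq z x) => // ->; case: (eqVneq x y).
Qed.

Lemma adj_vsetl G x y : adj G x y -> x \in vset G.
Proof. by move=> /edge_sub/subsetP; apply; rewrite !inE eqxx. Qed.

Lemma adj_vsetr G x y : adj G x y -> y \in vset G.
Proof. by rewrite adj_sym; exact: adj_vsetl. Qed.

(** The exponent of the variable of x in the product of the edge monomials
    listed in es; thus [edeg es =1 edeg fs] is equality of two monomials of
    the edge ring. *)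
Definition edeg es x : nat := count (fun e : {set V} => x \in e) es.

Lemma edeg_cons e es x : edeg (e :: es) x = (x \in e) + edeg es x.
Proof. by []. Qed.

Lemma edeg_cat es1 es2 x : edeg (es1 ++ es2) x = edeg es1 x + edeg es2 x.
Proof. exact: count_cat. Qed.

Lemma edeg_rem e es x : e \in es -> edeg es x = (x \in e) + edeg (rem e es) x.
Proof. by move=> ees; rewrite /edeg (permP (perm_to_rem ees)). Qed.

Lemma edeg_gt0 es x : (0 < edeg es x) = has (fun e : {set V} => x \in e) es.
Proof. by rewrite /edeg has_count. Qed.

Definition exchangeable G e f ms : Prop := exists g h ms',
  [/\ g \in eset G, h \in eset G, {subset ms' <= eset G},
    edeg ms =1 edeg (g :: ms') & edeg [:: g; f] =1 edeg [:: e; h]].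

(** Ideal-theoretically: the colon ideal (e) : f is generated by edges. The
    lists ms are the monomials of this colon ideal, and g is an edge that
    belongs to it and divides ms. *)
Definition exchange G : Prop := forall e f ms ns,
  e \in eset G -> f \in eset G -> e != f ->
  {subset ms <= eset G} -> {subset ns <= eset G} ->
  edeg (f :: ms) =1 edeg (e :: ns) ->
  exchangeable G e f ms.

Lemma edges_cons G e es : {subset e :: es <= eset G} <->
  e \in eset G /\ {subset es <= eset G}.
Proof.
split=> [sub|[eG sub] f].
  by split=> [|f fes]; apply: sub; rewrite !inE ?eqxx ?fes ?orbT.
by rewrite inE => /predU1P[->|/sub].
Qed.

Lemma edges_rem G e es : {subset es <= eset G} -> {subset rem e es <= eset G}.
Proof. by move=> sub f /mem_rem/sub. Qed.

Lemma edges_cat G es1 es2 : {subset es1 <= eset G} -> {subset es2 <= eset G} ->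
  {subset es1 ++ es2 <= eset G}.
Proof. by move=> s1 s2 f; rewrite mem_cat => /orP[/s1|/s2]. Qed.

Lemma sum_edeg G es : {subset es <= eset G} -> \sum_x edeg es x = (size es).*2.
Proof.
elim: es => [|e es IH]; first by rewrite big1.
move=> /edges_cons[eG /IH {}IH].
rewrite (eq_bigr (fun x => (x \in e) + edeg es x)) // big_split /= IH.
suff -> : \sum_x (x \in e : nat) = #|e| by rewrite (edge_card eG).
rewrite -sum1_card [RHS]big_mkcond /=; apply: eq_bigr => x _.
by case: (x \in e).
Qed.

Lemma size_edeg G es fs : {subset es <= eset G} -> {subset fs <= eset G} ->
  edeg es =1 edeg fs -> size es = size fs.
Proof.
move=> sub1 sub2 eq_d; apply: double_inj.
by rewrite -(sum_edeg sub1) -(sum_edeg sub2); apply: eq_bigr => x _; apply: eq_d.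
Qed.

Definition colouring G (col : pred V) := forall x y, adj G x y -> col x != col y.

Definition colourable G := exists col, colouring G col.

(** Every edge contributes exactly one to each of the two sides. *)
Lemma colouring_sum G col es : colouring G col -> {subset es <= eset G} ->
  \sum_(x | col x) edeg es x = \sum_(x | ~~ col x) edeg es x.
Proof.
move=> colG; elim: es => [|e es IH]; first by rewrite !big1.
move=> /edges_cons[eG /IH {}IH].
have D P : \sum_(x | P x) edeg (e :: es) x =
    \sum_(x | P x) (x \in e) + \sum_(x | P x) edeg es x by rewrite -big_split.
rewrite !D IH; congr addn => {D IH}.
have [a [b [ab -> /colG]]] := edgeP eG.
wlog ca : a b ab / col a => [W|] cab.
  have [/W|ca] := boolP (col a); first by apply.
  by rewrite setUC; apply: W; rewrite 1?eq_sym //; move: cab ca; do 2!case: (col _).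
have cb : ~~ col b by move: cab; rewrite ca; case: (col b).
have S (P : pred V) u w : P u -> ~~ P w -> \sum_(x | P x) (x \in [set u; w]) = 1.
  move=> Pu Pw; rewrite (bigD1 u) //= !inE eqxx /= big1 // => i /andP[Pi iu].
  by rewrite !inE (negbTE iu) /=; case: eqP Pi Pw => // -> ->.
by rewrite (S col) // setUC (S (predC col)) //= negbK.
Qed.

Definition realizable G (w : V -> nat) :=
  exists2 es, {subset es <= eset G} & edeg es =1 w.

(** Comparing degrees on e in g * f = e * h forces g = e when f is disjoint from
    e; then e cancels. *)
Lemma exchange_disjoint G e f w : exchange G -> e \in eset G -> f \in eset G ->
  [disjoint e & f] ->
  realizable G (fun x => w x + (x \in e)) -> realizable G (fun x => w x + (x \in f)) ->
  realizable G w.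
Proof.
move=> exG eG fG dis [ms msG ms_deg] [ns nsG ns_deg].
have [||g [h [ms' [gG hG ms'G dms dgf]]]] := exG e f ms ns eG fG _ msG nsG.
- apply: contraTneq dis => ->; rewrite -setI_eq0 setIid -card_gt0.
  by rewrite (edge_card fG).
- by move=> x; rewrite !edeg_cons ms_deg ns_deg; lia.
have eg : e = g.
  apply/eqP; rewrite eqEcard (edge_card eG) (edge_card gG) leqnn andbT.
  apply/subsetP => x xe; move: (dgf x); rewrite !edeg_cons xe.
  by rewrite (disjointFr dis xe); case: (x \in g).
exists ms' => // x; have := dms x; rewrite ms_deg edeg_cons eg; lia.
Qed.

(** Pairs are cancelled one at a time: adding the remaining edges of one list to
    a realization that uses the other list keeps both hypotheses of the
    one-pair case available. *)
Lemma exchange_disjoint_seq G es fs w : exchange G ->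
  {subset es <= eset G} -> {subset fs <= eset G} ->
  (forall e f, e \in es -> f \in fs -> [disjoint e & f]) ->
  realizable G (fun x => w x + edeg es x) -> realizable G (fun x => w x + edeg fs x) ->
  realizable G w.
Proof.
move=> exG.
have ext w1 w2 : w1 =1 w2 -> realizable G w1 -> realizable G w2.
  by move=> w12 [s sG sw]; exists s => // x; rewrite sw w12.
have add es' w' : {subset es' <= eset G} -> realizable G w' ->
    realizable G (fun x => w' x + edeg es' x).
  move=> es'G [s sG sw]; exists (s ++ es'); first exact: edges_cat.
  by move=> x; rewrite edeg_cat sw.
have one e w' : e \in eset G -> {subset fs <= eset G} ->
    (forall f, f \in fs -> [disjoint e & f]) -> realizable G (fun x => w' x + (x \in e)) ->
    realizable G (fun x => w' x + edeg fs x) -> realizable G w'.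
  move=> eG; elim: (fs) w' => [|f fs' IH] w' fsG dis we wf.
    by apply: ext wf => x; rewrite /= addn0.
  have [fG fs'G] := (edges_cons _ _ _).1 fsG.
  apply: IH => //; first by move=> f' f'fs; apply: dis; rewrite inE f'fs orbT.
  apply: (@exchange_disjoint G e f) => //; first by apply: dis; rewrite inE eqxx.
    by apply: (ext _ _ _ (add _ _ fs'G we)) => x; lia.
  by apply: ext wf => x; rewrite edeg_cons; lia.
elim: es w => [|e es IH] w esG fsG dis we wf.
  by apply: ext we => x; rewrite /= addn0.
have [eG es'G] := (edges_cons _ _ _).1 esG.
apply: IH => //; first by move=> e' f e'es; apply: dis; rewrite inE e'es orbT.
apply: (one e) => //.
- by move=> f; apply: dis; rewrite inE eqxx.
- by apply: ext we => x; rewrite edeg_cons; lia.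
- by apply: (ext _ _ _ (add _ _ es'G wf)) => x; lia.
Qed.

(** For a walk x, u1, ..., u2k, y the edges x u1, u2 u3, ..., u2k y cover x and
    y in addition to what u1 u2, u3 u4, ... cover. *)
Lemma odd_walk_realizable G x p y : path (adj G) x (rcons p y) -> ~~ odd (size p) ->
  exists es, [/\ {subset es <= eset G},
    (forall e z, e \in es -> z \in e -> z \in p) &
    realizable G (fun z => (z == x) + (z == y) + edeg es z)].
Proof.
have [n] := ubnP (size p); elim: n x p => // n IH x [|u [|v p]] //= pn.
  rewrite andbT => xy _; exists [::]; split=> //; exists [:: [set x; y]].
    by move=> e; rewrite inE => /eqP->.
  by move=> z; rewrite edeg_cons /= in_set2_nat ?(adj_neq xy).
move=> /and3P[xu uv vp]; rewrite negbK => ep.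
have [es [esG es_p [fs fsG fs_deg]]] := IH v p (ltnW pn) vp ep.
exists ([set u; v] :: es); split.
- by apply/edges_cons.
- move=> e z; rewrite inE => /predU1P[->|/es_p H /H zp]; rewrite !inE ?zp ?orbT //.
  by case/orP => ->; rewrite ?orbT.
exists ([set x; u] :: fs); first by apply/edges_cons.
by move=> z; rewrite !edeg_cons fs_deg !in_set2_nat ?(adj_neq xu) ?(adj_neq uv) //; lia.
Qed.

(** The interiors being disjoint, the inner edges of the two walks can be
    cancelled against each other, so the two vertices x and y form an edge
    by themselves. The case x = y excludes two odd closed walks at x with
    disjoint interiors. *)
Lemma two_odd_walks_adj G x y p q : exchange G ->
  path (adj G) x (rcons p y) -> path (adj G) x (rcons q y) ->
  ~~ odd (size p) -> ~~ odd (size q) -> (forall z, z \in p -> z \notin q) ->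
  adj G x y.
Proof.
move=> exG xp xq ep eq_ dis.
have [es [esG esp wes]] := odd_walk_realizable xp ep.
have [fs [fsG fsq wfs]] := odd_walk_realizable xq eq_.
have [|s sG s_deg] := exchange_disjoint_seq exG esG fsG _ wes wfs.
  move=> e f ees ffs; apply/pred0P => z /=; apply/negP => /andP[ze zf].
  by have := dis z (esp _ _ ees ze); rewrite (fsq _ _ ffs zf).
have : 0 < edeg s x by rewrite s_deg eqxx.
rewrite edeg_gt0 => /hasP[e e_s xe].
have [y' [xy' e_def xy'_adj]] := edge_at (sG _ e_s) xe.
have : 0 < edeg s y'.
  by rewrite edeg_gt0; apply/hasP; exists e => //; rewrite e_def !inE eqxx orbT.
rewrite s_deg (eq_sym y') (negbTE xy') /= add0n lt0b => /eqP <- //.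
Qed.

End Exchange.

(** * Induced subgraphs and isomorphisms of edge monoids *)

Section Subgraphs.
Variable V : finType.
Implicit Types (G H : sgraph V) (e f g h : {set V}) (ms ns es : seq {set V}).
Implicit Types (x y z v : V) (W : {set V}).

Lemma sgraph_eq G H : vset G = vset H -> eset G = eset H -> G = H.
Proof.
case: G H => [A E p] [B F q] /= eqV eqE; move: p q; rewrite eqV eqE => p q.
by rewrite (eq_irrelevance p q).
Qed.

Lemma adj_induced G W x y :
  adj (induced G W) x y = [&& adj G x y, x \in W & y \in W].
Proof.
rewrite /adj inE subsetI; case xy : (_ \in eset G) => //=.
by rewrite (edge_sub xy) /= subUset !sub1set.
Qed.

Lemma adj_delv G v x y : adj (delv G v) x y = [&& adj G x y, x != v & y != v].
Proof.
rewrite adj_induced !inE; case xy : (adj G x y) => //=.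
by rewrite (adj_vsetl xy) (adj_vsetr xy) !andbT.
Qed.

Lemma vset_delv G v : vset (delv G v) = vset G :\ v.
Proof. by apply/setP => x; rewrite !inE andbCA andbb. Qed.

Lemma sub_induced G W : subgraph (induced G W) G.
Proof. by rewrite /subgraph subsetIl; apply/subsetP => e; rewrite inE => /andP[]. Qed.

Lemma edeg_vset G es x : {subset es <= eset G} -> 0 < edeg es x -> x \in vset G.
Proof.
by move=> sub; rewrite edeg_gt0 => /hasP[e /sub/edge_sub/subsetP]; apply.
Qed.

(** Edges dividing a monomial supported on W lie inside W, so the exchange takes
    place in the induced subgraph. *)
Lemma exchange_induced G W : exchange G -> exchange (induced G W).
Proof.
move=> exG e f ms ns eW fW ef msW nsW deg_eq.
have up : {subset eset (induced G W) <= eset G} by move=> e'; rewrite inE => /andP[].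
have down es : {subset es <= eset G} ->
    (forall x, 0 < edeg es x -> x \in vset (induced G W)) ->
    {subset es <= eset (induced G W)}.
  move=> esG deg_es e' e's; rewrite inE esG //=; apply/subsetP => x xe'.
  by apply: deg_es; rewrite edeg_gt0; apply/hasP; exists e'.
have upS es : {subset es <= eset (induced G W)} -> {subset es <= eset G}.
  by move=> esW e' /esW/up.
have [g [h [ms' [gG hG ms'G dms dgh]]]] :=
  exG e f ms ns (up e eW) (up f fW) ef (upS ms msW) (upS ns nsW) deg_eq.
have gms'W : {subset g :: ms' <= eset (induced G W)}.
  apply: down => [|x]; first exact/edges_cons.
  by rewrite -dms; apply: edeg_vset.
have [gW ms'W] := (edges_cons _ _ _).1 gms'W.
have ehW : {subset [:: e; h] <= eset (induced G W)}.
  apply: down => [|x].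
    by apply/edges_cons; split; [exact: up | apply/edges_cons].
  by rewrite -dgh; apply: edeg_vset; apply/edges_cons; split=> //; apply/edges_cons.
by exists g, h, ms'; split=> //; apply: ehW; rewrite !inE eqxx orbT.
Qed.

End Subgraphs.

(** A bijection of the edges under which the same relations hold between edge
    monomials: an isomorphism of edge rings that maps edges to edges. *)
Record edge_iso (V V' : finType) (G : sgraph V) (G' : sgraph V')
    (phi : {set V} -> {set V'}) (psi : {set V'} -> {set V}) : Prop := EdgeIso {
  iso_to : {in eset G, forall e, phi e \in eset G'};
  iso_from : {in eset G', forall e, psi e \in eset G};
  iso_toK : {in eset G, cancel phi psi};
  iso_fromK : {in eset G', cancel psi phi};
  iso_edeg : forall es fs, {subset es <= eset G'} -> {subset fs <= eset G'} ->
    edeg es =1 edeg fs <-> edeg (map psi es) =1 edeg (map psi fs) }.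

Lemma map_edges (V V' : finType) (G : sgraph V) (G' : sgraph V') phi es :
  {in eset G, forall e, phi e \in eset G'} -> {subset es <= eset G} ->
  {subset map phi es <= eset G'}.
Proof. by move=> phiG sub _ /mapP[e /sub/phiG phie ->]. Qed.

Lemma edge_iso_sym (V V' : finType) (G : sgraph V) (G' : sgraph V') phi psi :
  edge_iso G G' phi psi -> edge_iso G' G psi phi.
Proof.
case=> to from toK fromK deg; split=> // es fs esG fsG.
have mK (s : seq {set V}) : {subset s <= eset G} -> map psi (map phi s) = s.
  by move=> sG; rewrite -map_comp map_id_in // => e /sG/toK.
rewrite deg; [by rewrite !mK | exact: map_edges to esG | exact: map_edges to fsG].
Qed.

Lemma exchange_iso (V V' : finType) (G : sgraph V) (G' : sgraph V') phi psi :
  edge_iso G G' phi psi -> exchange G -> exchange G'.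
Proof.
case=> to from toK fromK deg exG e f ms ns eG fG ef msG nsG deg_eq.
have [||||g [h [ms' [gG hG ms'G dms dgh]]]] :=
    exG (psi e) (psi f) (map psi ms) (map psi ns) (from _ eG) (from _ fG).
- by apply: contraNneq ef => /(congr1 phi); rewrite !fromK // => ->.
- exact: map_edges from msG.
- exact: map_edges from nsG.
- by apply/(deg (f :: ms) (e :: ns)) => //; apply/edges_cons.
exists (phi g), (phi h), (map phi ms').
have ms'K : map psi (map phi ms') = ms'.
  by rewrite -map_comp map_id_in // => e' /ms'G/toK.
have sub1 a : a \in eset G' -> {subset [:: a] <= eset G'}.
  by move=> aG; apply/edges_cons.
split; rewrite ?to //; first exact: map_edges to ms'G.
- apply/deg => //=; last by rewrite toK ?ms'K.
  by apply/edges_cons; split; [exact: to | exact: map_edges to ms'G].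
- by apply/deg; rewrite /= ?toK //; apply/edges_cons; split; rewrite ?to //;
    apply: sub1; rewrite ?to.
Qed.

Section SplitIso.
Variables (V : finType) (G : sgraph V) (v : V) (V1 V2 : {set V}).
Hypotheses (vG : v \in vset G) (bip : bipartition (delv G v) V1 V2).
Let G' := split_graph G v V1 V2.

Let V12 x : x != v -> x \in vset G -> (x \in V2) = (x \notin V1).
Proof.
case: bip => cov dis _ xv xG.
have : x \in V1 :|: V2 by rewrite cov vset_delv !inE xv.
rewrite inE => /orP[xV|xV]; first by rewrite (disjointFr dis xV) xV.
by rewrite (disjointFl dis xV) xV.
Qed.

Let v12 : (v \in V1 = false) * (v \in V2 = false).
Proof.
case: bip => cov dis _; have : v \notin V1 :|: V2 by rewrite cov vset_delv !inE eqxx.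
by rewrite inE negb_or => /andP[/negbTE-> /negbTE->].
Qed.

Lemma split_edge_cases (P : {set option V} -> Prop) :
  (forall x y, adj G x y -> x \in V1 -> y \in V2 -> P [set Some x; Some y]) ->
  (forall x, adj G x v -> x \in V1 -> P [set Some x; Some v]) ->
  (forall x, adj G x v -> x \in V2 -> P [set Some x; None]) ->
  {in eset G', forall e, P e}.
Proof.
move=> P12 P1 P2 e; rewrite inE => /orP[]; last first.
  by move=> /imsetP[x]; rewrite inE => /andP[xV xv] ->; apply: P2.
rewrite inE => /orP[] /imsetP[x]; last by rewrite inE => /andP[xV xv] ->; apply: P1.
move=> xG ->; case: bip => _ _ /(_ _ xG)[a [b [aV bV x_ab]]].
rewrite x_ab imsetU !imset_set1; apply: P12 => //.
by move: xG; rewrite x_ab -[_ \in _]/(adj _ a b) adj_delv => /and3P[].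
Qed.

Lemma split_adj : 
  [/\ forall x y, adj G x y -> x \in V1 -> y \in V2 -> adj G' (Some x) (Some y),
      forall x, adj G x v -> x \in V1 -> adj G' (Some x) (Some v) &
      forall x, adj G x v -> x \in V2 -> adj G' (Some x) None].
Proof.
split=> x.
- move=> y xy x1 y2; rewrite /adj !in_setU; apply/orP; left; apply/orP; left.
  apply/imsetP; exists [set x; y]; last by rewrite imsetU !imset_set1.
  rewrite -[_ \in _]/(adj _ x y) adj_delv xy /=.
  by apply/andP; split; [apply: contraTneq x1 | apply: contraTneq y2] => ->; rewrite v12.
- move=> xv x1; rewrite /adj !in_setU; apply/orP; left; apply/orP; right.
  by apply/imsetP; exists x; rewrite // inE x1.
- move=> xv x2; rewrite /adj !in_setU; apply/orP; right.
  by apply/imsetP; exists x; rewrite // inE x2.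
Qed.

(** The new vertex joins the part V1 and the old copy of v the part V2, because
    their neighbours lie in V2 and V1 respectively. *)
Definition split_colour (o : option V) := if o is Some x then x \in V1 else true.

Lemma split_colouring : colouring G' split_colour.
Proof.
move=> a b ab.
suff : forall e, e \in eset G' -> e = [set a; b] -> split_colour a != split_colour b.
  by apply; first exact: ab.
have V21 x : x \in V2 -> x \in V1 = false by case: bip => _ dis _ /(disjointFl dis).
have D (c d : option V) : split_colour c != split_colour d -> [set c; d] = [set a; b] ->
    split_colour a != split_colour b.
  move=> cd cd_ab.
  have : (c \in [set a; b]) && (d \in [set a; b]) by rewrite -cd_ab !inE !eqxx orbT.
  rewrite !inE => /andP[/orP[]/eqP cE /orP[]/eqP dE]; move: cd; rewrite cE dE ?eqxx //.
  by rewrite eq_sym.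
apply: split_edge_cases => [x y _ x1 y2|x _ x1|x _ x2]; apply: D => /=.
- by rewrite x1 V21.
- by rewrite x1 v12.
- by rewrite V21.
Qed.

Definition merge_edge (e : {set option V}) : {set V} := [set odflt v o | o in e].

Definition split_edge (e : {set V}) : {set option V} :=
  if (v \in e) && [exists x in e, x \in V2] then None |: [set Some x | x in e :\ v]
  else [set Some x | x in e].

Lemma merge_edge2 a b : merge_edge [set a; b] = [set odflt v a; odflt v b].
Proof. by rewrite /merge_edge imsetU !imset_set1. Qed.

Lemma split_edge12 x y : x \in V1 -> y \in V2 ->
  split_edge [set x; y] = [set Some x; Some y].
Proof.
move=> x1 y2; rewrite /split_edge ifF ?imsetU ?imset_set1 // !inE.
have xv : v != x by apply: contraTneq x1 => <-; rewrite v12.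
have yv : v != y by apply: contraTneq y2 => <-; rewrite v12.
by rewrite (negbTE xv) (negbTE yv).
Qed.

Lemma split_edge1v x : x \in V1 -> split_edge [set x; v] = [set Some x; Some v].
Proof.
move=> x1; rewrite /split_edge ifF ?imsetU ?imset_set1 //.
apply/negbTE; rewrite negb_and; apply/orP; right; apply/existsPn => y.
rewrite !inE; case: eqP => [->|_] /=.
  by case: bip => _ dis _; rewrite (disjointFr dis x1).
by case: eqP => // ->; rewrite v12.
Qed.

Lemma split_edge2v x : x \in V2 -> split_edge [set x; v] = [set Some x; None].
Proof.
move=> x2; rewrite /split_edge ifT; last first.
  by rewrite !inE eqxx orbT /=; apply/existsP; exists x; rewrite !inE eqxx.
have xv : x != v by apply: contraTneq x2 => ->; rewrite v12.
have -> : [set x; v] :\ v = [set x].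
  apply/setP => y; rewrite !inE; case: (eqVneq y v) => [->|_] /=.
    by rewrite eq_sym (negbTE xv).
  by rewrite orbF.
by rewrite imset_set1 setUC.
Qed.

Lemma orig_edge_cases (P : {set V} -> Prop) :
  (forall x y, adj G x y -> x \in V1 -> y \in V2 -> P [set x; y]) ->
  (forall x, adj G x v -> x \in V1 -> P [set x; v]) ->
  (forall x, adj G x v -> x \in V2 -> P [set x; v]) ->
  {in eset G, forall e, P e}.
Proof.
move=> P12 P1 P2 e eG; have [ve|ve] := boolP (v \in e).
  have [x [vx -> xv]] := edge_at eG ve; rewrite setUC.
  have xG := adj_vsetr xv; rewrite adj_sym in xv; rewrite eq_sym in vx.
  have := V12 vx xG; have [x1 _|x1 x2] := boolP (x \in V1); first exact: P1.
  by apply: P2; rewrite ?x2.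
have [|x [y [x1 y2 e_xy]]] := (let: And3 _ _ b := bip in b) e.
  rewrite inE eG; apply/subsetP => z ze.
  by rewrite !inE (subsetP (edge_sub eG) z ze) andbT /=; apply: contraNneq ve => <-.
by rewrite e_xy; apply: P12; rewrite // /adj -e_xy.
Qed.

Lemma edeg_merge es x : {subset es <= eset G'} ->
  edeg (map merge_edge es) x =
    if x == v then edeg es (Some v) + edeg es None else edeg es (Some x).
Proof.
elim: es => [|e es IH]; first by rewrite if_same.
move=> /edges_cons[eG' /IH {}IH].
rewrite [map _ _]/= !edeg_cons {}IH.
suff -> : (x \in merge_edge e) =
    (if x == v then (Some v \in e) + (None \in e) else (Some x \in e)) :> nat.
  by case: eqP => _ //; lia.
have odeg (a b : option V) : odflt v a != odflt v b -> (x \in merge_edge [set a; b]) =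
   (if x == v then (Some v \in [set a; b]) + (None \in [set a; b])
    else (Some x \in [set a; b])) :> nat.
  rewrite merge_edge2 !inE; case: a b => [a|] [b|] //=; rewrite ?eqxx // => ab.
  - by case: (x =P v) => [->|_] //; rewrite addn0.
  - case: (x =P v) => [->|_]; last by rewrite !orbF.
    by rewrite -[Some v == Some a]/(v == a) eq_sym (negbTE ab).
  - case: (x =P v) => [->|_] //.
    by rewrite -[Some v == Some b]/(v == b) (negbTE ab).
apply: (split_edge_cases (P := fun e => (x \in merge_edge e) =
    (if x == v then (Some v \in e) + (None \in e) else (Some x \in e)) :> nat)) eG'
  => [a b /adj_neq ab a1 b2|a /adj_neq av a1|a /adj_neq av a2]; exact: odeg.
Qed.

(** Merging the two copies of v only adds up their degrees. No information is
    lost: the split graph is 2-coloured with the copies in different parts,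
    so the degrees at the other vertices determine the difference of the two
    degrees. *)
Lemma split_iso : edge_iso G G' split_edge merge_edge.
Proof.
have [A12 A1 A2] := split_adj.
split.
- apply: orig_edge_cases => [x y xy x1 y2|x xv x1|x xv x2].
  + by rewrite split_edge12 //; apply: A12.
  + by rewrite split_edge1v //; apply: A1.
  + by rewrite split_edge2v //; apply: A2.
- by apply: split_edge_cases => [x y xy x1 y2|x xv x1|x xv x2]; rewrite merge_edge2.
- apply: orig_edge_cases => [x y xy x1 y2|x xv x1|x xv x2].
  + by rewrite split_edge12 // merge_edge2.
  + by rewrite split_edge1v // merge_edge2.
  + by rewrite split_edge2v // merge_edge2.
- apply: split_edge_cases => [x y xy x1 y2|x xv x1|x xv x2]; rewrite merge_edge2 /=.
  + exact: split_edge12.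
  + exact: split_edge1v.
  + exact: split_edge2v.
move=> es fs esG fsG; split=> [deg_eq x|deg_eq].
  by rewrite !edeg_merge // !deg_eq.
have degS x : x != v -> edeg es (Some x) = edeg fs (Some x).
  by move=> xv; have := deg_eq x; rewrite !edeg_merge // (negbTE xv).
have degv : edeg es (Some v) + edeg es None = edeg fs (Some v) + edeg fs None.
  by have := deg_eq v; rewrite !edeg_merge // eqxx.
have bal s : {subset s <= eset G'} ->
    edeg s None + \sum_(o | split_colour o && (o != None)) edeg s o =
    edeg s (Some v) + \sum_(o | ~~ split_colour o && (o != Some v)) edeg s o.
  move=> sG; have := colouring_sum split_colouring sG.
  by rewrite (bigD1 None) //= => ->; rewrite (bigD1 (Some v)) //= v12.
have E1 : \sum_(o | split_colour o && (o != None)) edeg es o =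
          \sum_(o | split_colour o && (o != None)) edeg fs o.
  apply: eq_bigr => -[x|] /andP[] //= x1 _; apply: degS.
  by apply: contraTneq x1 => ->; rewrite v12.
have E2 : \sum_(o | ~~ split_colour o && (o != Some v)) edeg es o =
          \sum_(o | ~~ split_colour o && (o != Some v)) edeg fs o.
  by apply: eq_bigr => -[x|] //= /andP[_ xv]; apply: degS.
have := bal _ esG; have := bal _ fsG; rewrite E1 E2 => bal1 bal2.
move=> [x|]; last by lia.
by have [->|xv] := eqVneq x v; [lia | exact: degS].
Qed.

End SplitIso.

(** * Complete bipartite graphs and K4 *)

Section Examples.
Variable V : finType.
Implicit Types (G H : sgraph V) (e f g h : {set V}) (ms ns es : seq {set V}).
Implicit Types (x y z v : V) (W : {set V}).

Lemma edeg_take_edge G ms e : {subset ms <= eset G} -> e \in ms ->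
  exists2 ms', {subset ms' <= eset G} & edeg ms =1 edeg (e :: ms').
Proof.
by move=> msG ems; exists (rem e ms) => [|x]; [exact: edges_rem | rewrite (edeg_rem x ems)].
Qed.

Lemma edeg_pair e f x : edeg [:: e; f] x = (x \in e) + (x \in f).
Proof. by rewrite !edeg_cons addn0. Qed.

(** The elementary quadratic relation e1 * e2 = f1 * f2 brings f1 into the
    product. *)
Lemma edeg_switch_pair G ms e1 e2 f1 f2 : {subset ms <= eset G} ->
  e1 \in ms -> e2 \in ms -> e1 != e2 -> f2 \in eset G ->
  edeg [:: e1; e2] =1 edeg [:: f1; f2] ->
  exists2 ms', {subset ms' <= eset G} & edeg ms =1 edeg (f1 :: ms').
Proof.
move=> msG e1ms e2ms e12 f2G deg_eq.
exists (f2 :: rem e2 (rem e1 ms)).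
  by apply/edges_cons; split=> //; do 2!apply: edges_rem.
have e2r : e2 \in rem e1 ms.
  by have := perm_mem (perm_to_rem e1ms) e2; rewrite e2ms inE eq_sym (negbTE e12).
move=> x; have := deg_eq x.
rewrite (edeg_rem x e1ms) (edeg_rem x e2r) !edeg_cons /=; lia.
Qed.

(** If all edges of ms contained c, then c would have degree [size ms + 1] in f
    :: ms, but it has at most degree [size ns = size ms] in e :: ns. *)
Lemma edge_avoiding G e f ms ns c : {subset ms <= eset G} -> {subset ns <= eset G} ->
  e \in eset G -> f \in eset G -> edeg (f :: ms) =1 edeg (e :: ns) ->
  c \in f -> c \notin e -> exists2 e', e' \in ms & c \notin e'.
Proof.
move=> msG nsG eG fG deg_eq cf ce.
have /hasP[e' e'ms ce'] : has (fun e' : {set V} => c \notin e') ms; last by exists e'.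
rewrite has_predC; apply/negP; rewrite all_count => /eqP all_c.
have fms : {subset f :: ms <= eset G} by apply/edges_cons.
have ens : {subset e :: ns <= eset G} by apply/edges_cons.
have := size_edeg fms ens deg_eq; have := deg_eq c.
have := count_size (fun e' : {set V} => c \in e') ns.
rewrite !edeg_cons cf (negbTE ce) /= /edeg all_c; lia.
Qed.

Lemma edge_covering e f ms ns b : edeg (f :: ms) =1 edeg (e :: ns) ->
  b \in e -> b \notin f -> exists2 e', e' \in ms & b \in e'.
Proof.
move=> deg_eq be bf.
have : 0 < edeg ms b by have := deg_eq b; rewrite !edeg_cons be (negbTE bf); lia.
by rewrite edeg_gt0 => /hasP.
Qed.

Lemma bipartition_colouring G V1 V2 : bipartition G V1 V2 -> colouring G (mem V1).
Proof.
case=> cov dis bip x y xy; have [a [b [a1 b2 /setP ab]]] := bip _ xy.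
have b1 := disjointFl dis b2.
have := ab x; have := ab y; rewrite !inE !eqxx orbT /=.
move=> /esym/orP[]/eqP yE /esym/orP[]/eqP xE; rewrite xE yE ?a1 ?b1 //;
  by move: xy; rewrite xE yE adj_irr.
Qed.

Lemma complete_bipartite_colourable G : complete_bipartite G -> colourable G.
Proof. by move=> [V1 [V2 [/bipartition_colouring bip _]]]; exists (mem V1). Qed.

Lemma bipartition_atl G V1 V2 e a : bipartition G V1 V2 -> e \in eset G ->
  a \in V1 -> a \in e -> exists2 y, y \in V2 & e = [set a; y].
Proof.
case=> _ dis bip /bip[x [y [x1 y2 ->]]] a1; rewrite !inE => /orP[]/eqP aE; subst a.
  by exists y.
by move: a1; rewrite (disjointFl dis y2).
Qed.

Lemma bipartition_sym G V1 V2 : bipartition G V1 V2 -> bipartition G V2 V1.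
Proof.
case=> cov dis bip; split; rewrite 1?setUC 1?disjoint_sym // => e /bip[x [y [? ? ->]]].
by exists y, x; rewrite setUC.
Qed.

(** When e and f share a vertex, any edge of ms through the other end of e can
    serve as g. When they are disjoint, the edges of ms through the two ends
    of e are traded for e itself and the edge joining their far ends. *)
Lemma complete_bipartite_exchange G : complete_bipartite G -> exchange G.
Proof.
move=> [V1 [V2 [bip full]]] e f ms ns eG fG ef msG nsG deg_eq.
have dis : [disjoint V1 & V2] by case: bip.
have neq12 x y : x \in V1 -> y \in V2 -> x != y.
  by move=> x1 y2; apply: contraTneq x1 => ->; rewrite (disjointFl dis).
have [a [b [a1 b2 eE]]] := (let: And3 _ _ P := bip in P) e eG.
have [a' [b' [a'1 b'2 fE]]] := (let: And3 _ _ P := bip in P) f fG.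
have one_end g h : g \in ms -> h \in eset G -> edeg [:: g; f] =1 edeg [:: e; h] ->
    exchangeable G e f ms.
  move=> gms hG dgh; have [ms' ms'G dms] := edeg_take_edge msG gms.
  by exists g, h, ms'; split=> //; apply: msG.
have [aa'|aa'] := eqVneq a a'.
  have bb' : b != b' by apply: contraNneq ef => bb'; rewrite eE fE aa' bb'.
  have [||e1 e1ms be1] := edge_covering (b := b) deg_eq.
  - by rewrite eE !inE eqxx orbT.
  - by rewrite fE !inE negb_or bb' andbT eq_sym neq12.
  have [d d1 e1E] := bipartition_atl (bipartition_sym bip) (msG _ e1ms) b2 be1.
  rewrite setUC in e1E.
  apply: (one_end e1 [set d; b'] e1ms); first exact: full.
  move=> x; rewrite e1E eE fE aa' !edeg_pair !in_set2_nat ?neq12 //; clear; lia.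
have [bb'|bb'] := eqVneq b b'.
  have [||e1 e1ms ae1] := edge_covering (b := a) deg_eq.
  - by rewrite eE !inE eqxx.
  - by rewrite fE !inE negb_or aa' neq12.
  have [d d2 e1E] := bipartition_atl bip (msG _ e1ms) a1 ae1.
  apply: (one_end e1 [set a'; d] e1ms); first exact: full.
  by move=> x; rewrite e1E eE fE bb' !edeg_pair !in_set2_nat ?neq12 //; clear; lia.
exists e, f; suff [ms' ms'G dms] : exists2 ms', {subset ms' <= eset G} & edeg ms =1 edeg (e :: ms').
  by exists ms'.
have [||e1 e1ms ae1] := edge_covering (b := a) deg_eq.
- by rewrite eE !inE eqxx.
- by rewrite fE !inE negb_or aa' neq12.
have [||e2 e2ms be2] := edge_covering (b := b) deg_eq.
- by rewrite eE !inE eqxx orbT.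
- by rewrite fE !inE negb_or bb' andbT eq_sym neq12.
have [y y2 e1E] := bipartition_atl bip (msG _ e1ms) a1 ae1.
have [x x1 e2E] := bipartition_atl (bipartition_sym bip) (msG _ e2ms) b2 be2.
rewrite setUC in e2E.
have [e12|e12] := eqVneq e1 e2.
  apply: edeg_take_edge => //; suff -> : e = e1 by [].
  apply/esym/eqP; rewrite eE eqEcard cards2 (edge_card (msG _ e1ms)) ltnS leq_b1 andbT.
  rewrite e1E; move: be2; rewrite -e12 e1E !inE => /orP[]/eqP bE.
    by move: (neq12 _ _ a1 b2); rewrite bE eqxx.
  by rewrite bE.
apply: (edeg_switch_pair msG e1ms e2ms e12 (f2 := [set x; y])); first exact: full.
move=> z; rewrite e1E e2E eE !edeg_pair !in_set2_nat ?neq12 //; clear; lia.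
Qed.

(** Only six edges can occur in ms. Those through an end of e outside f, and
    those avoiding a vertex of f outside e, which [edge_covering] and
    [edge_avoiding] provide, leave few cases, and in each of them one
    quadratic relation of K4 produces g. *)
Lemma K4_exchange G : is_K4 G -> exchange G.
Proof.
move=> [card4 full] e f ms ns eG fG ef msG nsG deg_eq.
have two x y : x \in vset G -> y \in vset G -> x != y -> [set x; y] \in eset G.
  by move=> xG yG xy; apply: full.
have [c cf ce] : exists2 c, c \in f & c \notin e.
  apply/subsetPn; apply: contraNN ef => fe.
  by rewrite eq_sym eqEcard fe (edge_card eG) (edge_card fG).
have [y [cy fE _]] := edge_at fG cf.
have [a [b [ab eE _]]] := edgeP eG.
have cG : c \in vset G by apply: (subsetP (edge_sub fG)).
have aG : a \in vset G by apply: (subsetP (edge_sub eG)); rewrite eE !inE eqxx.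
have bG : b \in vset G by apply: (subsetP (edge_sub eG)); rewrite eE !inE eqxx orbT.
have /andP[ca cb] : (c != a) && (c != b) by move: ce; rewrite eE !inE negb_or.
have [d dG dabc] : exists2 d, d \in vset G & d \notin [set a; b; c].
  apply/subsetPn/negP => /subset_leq_card; rewrite card4 => le4.
  by have := leq_trans le4 (leq_card_setU _ _); rewrite cards2 cards1 ab.
move: dabc; rewrite !inE !negb_or => /andP[/andP[da db] dc].
have ba : b != a by rewrite eq_sym.
have ac : a != c by rewrite eq_sym.
have bc : b != c by rewrite eq_sym.
have ad : a != d by rewrite eq_sym.
have bd : b != d by rewrite eq_sym.
have cd : c != d by rewrite eq_sym.
have vE : vset G = [set a; b; c; d].
  apply/esym/eqP; rewrite eqEcard card4; apply/andP; split.
    by apply/subsetP => z; rewrite !inE -!orbA => /or4P[]/eqP->.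
  by rewrite setUC cardsU1 !inE !negb_or da db dc setUC cardsU1 !inE negb_or ca cb cards2 ab.
have six e' : e' \in eset G -> e' \in
    [:: [set a; b]; [set a; c]; [set a; d]; [set b; c]; [set b; d]; [set c; d]].
  move=> e'G; have [u [w [uw -> adjuw]]] := edgeP e'G.
  have := adj_vsetl adjuw; have := adj_vsetr adjuw; rewrite vE !inE -!orbA.
  move=> /or4P[]/eqP wE /or4P[]/eqP uE; move: uw; rewrite wE uE ?eqxx ?orbT // => _;
    by rewrite setUC eqxx ?orbT.
have through_b : b \notin f ->
    [|| [set a; b] \in ms, [set b; c] \in ms | [set b; d] \in ms].
  have be : b \in e by rewrite eE !inE eqxx orbT.
  move=> bf; have [e' e'ms] := edge_covering deg_eq be bf.
  have sixe := six _ (msG _ e'ms); move: sixe e'ms; rewrite !inE.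
  by move=> /or4P[/eqP->|/eqP->|/eqP->|/or3P[]/eqP->] e'ms;
    rewrite !inE ?e'ms ?orbT // ?(negbTE ba) ?(negbTE bc) ?(negbTE bd).
have through_a : a \notin f ->
    [|| [set a; b] \in ms, [set a; c] \in ms | [set a; d] \in ms].
  have ae : a \in e by rewrite eE !inE eqxx.
  move=> af; have [e' e'ms] := edge_covering deg_eq ae af.
  have sixe := six _ (msG _ e'ms); move: sixe e'ms; rewrite !inE.
  by move=> /or4P[/eqP->|/eqP->|/eqP->|/or3P[]/eqP->] e'ms;
    rewrite !inE ?e'ms ?orbT // ?(negbTE ab) ?(negbTE ac) ?(negbTE ad).
have off_c : [|| [set a; b] \in ms, [set a; d] \in ms | [set b; d] \in ms].
  have [e' e'ms] := edge_avoiding msG nsG eG fG deg_eq cf ce.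
  have sixe := six _ (msG _ e'ms); move: sixe e'ms; rewrite !inE.
  by move=> /or4P[/eqP->|/eqP->|/eqP->|/or3P[]/eqP->] e'ms;
    rewrite !inE ?e'ms ?eqxx ?orbT.
have dgP u1 w1 u2 w2 u3 w3 u4 w4 : u1 != w1 -> u2 != w2 -> u3 != w3 -> u4 != w4 ->
    (forall z, (z == u1) + (z == w1) + ((z == u2) + (z == w2)) =
               (z == u3) + (z == w3) + ((z == u4) + (z == w4))) ->
    edeg [:: [set u1; w1]; [set u2; w2]] =1 edeg [:: [set u3; w3]; [set u4; w4]].
  by move=> d1 d2 d3 d4 eqz z; rewrite !edeg_pair !in_set2_nat.
suff [g [h [gG hG [ms' ms'G dms] dgh]]] : exists g h, [/\ g \in eset G, h \in eset G,
    exists2 ms', {subset ms' <= eset G} & edeg ms =1 edeg (g :: ms') &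
    edeg [:: g; f] =1 edeg [:: e; h]].
  by exists g, h, ms'.
have take_ms g := edeg_take_edge (e := g) msG.
have ce_done : [set a; b] \in ms ->  exists g h, [/\ g \in eset G, h \in eset G,
    exists2 ms', {subset ms' <= eset G} & edeg ms =1 edeg (g :: ms') &
    edeg [:: g; f] =1 edeg [:: e; h]].
  by move=> abms; exists e, f; split=> //; rewrite eE; apply: take_ms.
have switch u1 w1 u2 w2 u3 w3 u4 w4 : [set u1; w1] \in ms -> [set u2; w2] \in ms ->
    u1 != w1 -> u2 != w2 -> u3 != w3 -> u4 != w4 ->
    u1 != u2 -> u1 != w2 -> [set u4; w4] \in eset G ->
    (forall z, (z == u1) + (z == w1) + ((z == u2) + (z == w2)) =
               (z == u3) + (z == w3) + ((z == u4) + (z == w4))) ->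
    exists2 ms', {subset ms' <= eset G} & edeg ms =1 edeg ([set u3; w3] :: ms').
  move=> m1 m2 d1 d2 d3 d4 u12 uw12 e4 eqz.
  apply: (edeg_switch_pair msG m1 m2 _ e4); last exact: dgP.
  by apply/eqP => /setP/(_ u1); rewrite !inE eqxx (negbTE u12) (negbTE uw12).
have : y \in vset G by apply: (subsetP (edge_sub fG)); rewrite fE !inE eqxx orbT.
rewrite vE !inE -!orbA => /or4P[]/eqP yE; last first.
(* When f = cd is disjoint from e, one of ab, ac * bd and ad * bc divides ms. *)
- have af : a \notin f by rewrite fE yE !inE negb_or ac ad.
  have bf : b \notin f by rewrite fE yE !inE negb_or bc bd.
  have off_d : [|| [set a; b] \in ms, [set a; c] \in ms | [set b; c] \in ms].
    have [||e' e'ms] := edge_avoiding msG nsG eG fG deg_eq (c := d).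
    - by rewrite fE yE !inE eqxx orbT.
    - by rewrite eE !inE negb_or da db.
    have sixe := six _ (msG _ e'ms); move: sixe e'ms; rewrite !inE.
    by move=> /or4P[/eqP->|/eqP->|/eqP->|/or3P[]/eqP->] e'ms;
      rewrite !inE ?e'ms ?eqxx ?orbT.
  have [/ce_done//|abms] := boolP ([set a; b] \in ms).
  exists e, f; split=> //; rewrite eE.
  have [/andP[m1 m2]|no] := boolP (([set a; c] \in ms) && ([set b; d] \in ms)).
    by apply: (switch _ _ _ _ _ _ c d m1 m2) => // [|z]; [exact: two | clear; lia].
  have [/andP[m1 m2]|no'] := boolP (([set a; d] \in ms) && ([set b; c] \in ms)).
    by apply: (switch _ _ _ _ _ _ c d m1 m2) => // [|z]; [exact: two | clear; lia].
  move: (through_a af) (through_b bf) off_c off_d abms no no'.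
  by do 5!case: (_ \in ms).
- by rewrite yE eqxx in cy.
(* When f = cb, one of ab, ad and ac * bd divides ms, and ac * bd = ad * bc. *)
- have af : a \notin f by rewrite fE yE !inE negb_or ab ac.
  have [/ce_done//|abms] := boolP ([set a; b] \in ms).
  exists [set a; d], [set c; d]; split; rewrite ?two //; last first.
    by rewrite fE eE yE; apply: dgP => // z; clear; lia.
  have [adms|adms] := boolP ([set a; d] \in ms); first exact: take_ms.
  move: (through_a af) off_c; rewrite (negbTE abms) (negbTE adms) !orbF /= => m1 m2.
  by apply: (switch _ _ _ _ _ _ b c m1 m2) => // [|z]; [exact: two | clear; lia].
- have bf : b \notin f by rewrite fE yE !inE negb_or bc ba.
  have [/ce_done//|abms] := boolP ([set a; b] \in ms).
  exists [set b; d], [set c; d]; split; rewrite ?two //; last first.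
    by rewrite fE eE yE; apply: dgP => // z; clear; lia.
  have [bdms|bdms] := boolP ([set b; d] \in ms); first exact: take_ms.
  move: (through_b bf) off_c; rewrite (negbTE abms) (negbTE bdms) !orbF /= => m1 m2.
  by apply: (switch _ _ _ _ _ _ a c m1 m2) => // [|z]; [exact: two | clear; lia].
Qed.

End Examples.

(** * Walks and 2-connected bipartite graphs *)

Section Walks.
Variable V : finType.
Implicit Types (G H : sgraph V) (e f g h : {set V}) (ms ns es : seq {set V}).
Implicit Types (x y z v t : V) (W : {set V}) (p q : seq V) (T : pred V).

Lemma rev_walk (e : rel V) x q y : symmetric e ->
  path e x (rcons q y) -> path e y (rcons (rev q) x).
Proof.
move=> e_sym; rewrite -rev_cons -(belast_rcons x q y) -{2}(last_rcons x q y).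
by rewrite rev_path; congr is_true; apply: eq_path.
Qed.

Lemma split_first_hit T p : has T p ->
  exists q y s, [/\ p = rcons q y ++ s, T y & all (predC T) q].
Proof.
elim: p => //= u p IH; have [Tu _|Tu /= /IH[q [y [s [-> Ty Tq]]]]] := boolP (T u).
  by exists [::], u, p.
by exists (u :: q), y, s; rewrite /= Tu.
Qed.

Lemma first_hit (e : rel V) T x p : path e x p -> has T p ->
  exists q y, [/\ path e x (rcons q y), T y & all (predC T) q].
Proof.
move=> xp /split_first_hit[q [y [s [pE Ty Tq]]]]; exists q, y; split=> //.
by move: xp; rewrite pE cat_path => /andP[].
Qed.

(** The parities of the pieces of a walk between consecutive visits to T add up,
    so a walk whose parity disagrees with the colours of its ends has a
    piece with the same defect. *)
Lemma unbalanced_ear (e : rel V) T (col : pred V) x p : path e x p -> T x -> T (last x p) ->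
  odd (size p) (+) col x (+) col (last x p) ->
  exists x' q y', [/\ path e x' (rcons q y'), T x', T y', all (predC T) q &
    odd (size q).+1 (+) col x' (+) col y'].
Proof.
have [n] := ubnP (size p); elim: n x p => // n IH x [|u p] pn xp Tx Ty par.
  by move: par; rewrite /= addbb.
have hasT : has T (u :: p) by apply/hasP; exists (last u p); rewrite // mem_last.
have [q [y [s [pE Ty' Tq]]]] := split_first_hit hasT.
move: xp pn par Ty; rewrite {}pE cat_path last_cat last_rcons size_cat size_rcons.
move=> /andP[xq ys] pn par Tl.
have [bad|good] := boolP (odd (size q).+1 (+) col x (+) col y).
  by exists x, q, y.
apply: (IH y s) => //.
  by move: pn; clear; lia.
move: par good; rewrite oddD /=.
by case: (odd (size q)); case: (odd (size s)); case: (col x); case: (col y);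
  case: (col (last y s)).
Qed.

Lemma path_colouring G col x p : colouring G col -> path (adj G) x p ->
  col (last x p) = col x (+) odd (size p).
Proof.
move=> colG; elim: p x => [|u p IH] x /=; first by rewrite addbF.
by move=> /andP[/colG xu /IH ->]; move: xu; case: (col x); case: (col u); case: (odd (size _)).
Qed.

Lemma delv_path G v x p : path (adj (delv G v)) x p -> path (adj G) x p /\ v \notin p.
Proof.
elim: p x => //= u p IH x; rewrite adj_delv inE negb_or.
by move=> /andP[/and3P[-> _ uv] /IH[-> ->]]; rewrite eq_sym uv.
Qed.

(** A path from x to z avoiding y ends with some u z. Its part from x to u and
    the walk x, y, z, u are odd with disjoint interiors, hence u is adjacent
    to x. *)
Lemma two_connected_common_neighbour G col x y z :
  exchange G -> two_connected G -> colouring G col ->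
  adj G x y -> adj G y z -> x != z ->
  exists2 u, u != y & adj G x u /\ adj G u z.
Proof.
move=> exG [_ delG] colG xy yz xz.
have yG := adj_vsetl yz.
have [||p] := connectP (delG y yG x z _ _).
- by rewrite vset_delv !inE (adj_vsetl xy) (adj_neq xy).
- by rewrite vset_delv !inE (adj_vsetr yz) eq_sym (adj_neq yz).
move=> /shortenP[{p}p xp uniq_p _].
case/lastP: p xp uniq_p => [|p z'] xp uniq_p; first by move=> zx; rewrite zx eqxx in xz.
rewrite last_rcons => zE; subst z'.
have [xpG yp] := delv_path xp.
have colxz : col x = col z.
  by move: (colG _ _ xy) (colG _ _ yz); case: (col x); case: (col y); case: (col z).
case/lastP: p xp uniq_p xpG yp => [|p u] xp uniq_p xpG yp.
  by move: xpG => /= /andP[/colG]; rewrite colxz eqxx.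
move: xpG; rewrite rcons_path last_rcons => /andP[xpu uz].
move: yp; rewrite !(mem_rcons, inE) !negb_or => /and3P[yz' yu yp].
exists u; first by rewrite eq_sym.
split=> //; apply: (two_odd_walks_adj exG xpu (q := [:: y; z])) => //=.
- by rewrite xy yz adj_sym uz.
- have := path_colouring colG xpu; rewrite last_rcons size_rcons /= colxz.
  by move: (colG _ _ uz); case: (col u); case: (col z); case: (odd (size _)).
- move=> w wp; rewrite !inE negb_or; apply/andP; split.
    by apply: contraNneq yp => <-.
  move: uniq_p => /= /andP[_].
  rewrite rcons_uniq mem_rcons inE negb_or => /andP[/andP[_ zp] _].
  by apply: contraNneq zp => <-.
Qed.

(** With u a second common neighbour of x and z, and u' one of y and w, the
    walks x, u, z, w and x, y, u', w are odd with disjoint interiors. *)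
Lemma two_connected_walk3 G col x y z w :
  exchange G -> two_connected G -> colouring G col ->
  adj G x y -> adj G y z -> adj G z w -> adj G x w.
Proof.
move=> exG twoG colG xy yz zw.
have [->//|xz] := eqVneq x z.
have [yw|yw] := eqVneq y w; first by rewrite -yw.
have [u uy [xu uz]] := two_connected_common_neighbour exG twoG colG xy yz xz.
have [u' u'z [yu' u'w]] := two_connected_common_neighbour exG twoG colG yz zw yw.
apply: (two_odd_walks_adj exG (p := [:: u; z]) (q := [:: y; u'])) => //=.
- by rewrite xu uz zw.
- by rewrite xy yu' u'w.
have uu' : u != u'.
  apply: contraNneq (colG _ _ uz) => uE; move: (colG _ _ yu') (colG _ _ yz); rewrite -uE.
  by case: (col u); case: (col y); case: (col z).
move=> t; rewrite !inE => /orP[]/eqP->; first by rewrite negb_or uy uu'.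
by rewrite negb_or eq_sym (adj_neq yz) eq_sym.
Qed.

Lemma colouring_bipartition G (col : pred V) : colouring G col ->
  bipartition G [set x in vset G | col x] [set x in vset G | ~~ col x].
Proof.
move=> colG; split.
- by apply/setP => x; rewrite !inE -andb_orr orbN andbT.
- apply/pred0P => x /=; rewrite !inE; case: (col x); by rewrite ?andbF.
move=> e /edgeP[x [y [_ -> xy]]]; have := colG _ _ xy.
have [cx cy|cx cy] := boolP (col x); [exists x, y | exists y, x]; split;
  rewrite ?inE ?(adj_vsetl xy) ?(adj_vsetr xy) //=.
- by move: cy; case: (col y).
- by rewrite setUC.
Qed.

(** A walk between the two parts has odd length and can be shortened by
    replacing its first three steps with one edge. *)
Lemma two_connected_complete_bipartite G :
  exchange G -> two_connected G -> colourable G -> complete_bipartite G.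
Proof.
move=> exG twoG [col colG].
exists [set x in vset G | col x], [set x in vset G | ~~ col x]; split.
  exact: colouring_bipartition.
move=> x y; rewrite !inE => /andP[xG cx] /andP[yG cy].
have /connectP[p] : connect (adj G) x y by case: twoG => conG _; apply: conG.
have [n] := ubnP (size p); elim: n p x cx {xG} => // n IH p x cx pn xp yE.
have := path_colouring colG xp; rewrite -yE cx (negbTE cy) /= => /esym/negbFE.
case: p pn xp yE => [|a [|b [|c p]]] //= pn.
  by move=> /andP[xa _] ->.
move=> /and4P[xa ab bc cp] yE; rewrite !negbK => odd_p.
have xc := two_connected_walk3 exG twoG colG xa ab bc.
by apply: (IH (c :: p)) => //=; [exact: ltnW | rewrite xc].
Qed.

Definition odd_closed_walk G x p :=
  [/\ path (adj G) x p, last x p = x & odd (size p)].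

Lemma odd_closed_walk_at G x z p : connected G -> x \in vset G ->
  odd_closed_walk G z p -> exists q, odd_closed_walk G x q.
Proof.
move=> conG xG [zp last_p odd_p].
have zG : z \in vset G by case: p zp last_p odd_p => //= u p /andP[/adj_vsetl].
have /connectP[s xs zE] := conG _ _ xG zG.
exists (s ++ p ++ rev (belast x s)); split.
- rewrite !cat_path xs -zE zp last_p /= zE.
  by rewrite rev_path (eq_path (e' := adj G)) // => a b; rewrite adj_sym.
- rewrite !last_cat -zE last_p; case: s {xs zE}(zE) => //= u s ->.
  by rewrite rev_cons last_rcons.
- by rewrite !size_cat size_rev size_belast !oddD odd_p addbCA addbb.
Qed.

(** Colour a vertex by the parity of the walks that reach it from a fixed root. *)
Lemma colourable_of_odd_closed_walk_free G : connected G ->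
  (forall x p, ~ odd_closed_walk G x p) -> colourable G.
Proof.
move=> conG free; have [V0|[r rG]] := set_0Vmem (vset G).
  by exists xpred0 => x y /adj_vsetl; rewrite V0 inE.
exists (fun x => `[< exists p, [/\ path (adj G) r p, last r p = x & ~~ odd (size p)] >]).
move=> x y xy.
have walk z : z \in vset G -> exists2 p, path (adj G) r p & last r p = z.
  by move=> zG; have /connectP[p rp ->] := conG _ _ rG zG; exists p.
case: asboolP => [[p [rp px ep]]|nx]; case: asboolP => [[q [rq qy eq_]]|ny] //; exfalso.
  apply: (free r (p ++ y :: rev (belast r q))); split.
  - rewrite cat_path /= rp px xy /= -qy.
    by rewrite rev_path (eq_path (e' := adj G)) // => a b; rewrite adj_sym.
  - rewrite last_cat /= -{1}qy; case: q {rq qy eq_} => //= u q.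
    by rewrite rev_cons last_rcons.
  - by rewrite size_cat /= size_rev size_belast addnS /= oddD (negbTE ep) (negbTE eq_).
have [p rp px] := walk x (adj_vsetl xy).
have op : odd (size p) by apply/negPn/negP => ep; apply: nx; exists p.
apply: ny; exists (rcons p y); split; rewrite ?last_rcons ?size_rcons /= ?negbK //.
by rewrite rcons_path rp px.
Qed.

End Walks.

(** * Shortest odd cycles *)

Section ShortestOddCycle.
Variable V : finType.
Implicit Types (G H : sgraph V) (x y z v t : V) (p q : seq V) (c : nat -> V).

(** The cycle is a periodic sequence of vertices, so that arcs passing through
    the base point need no special treatment, and its length is minimal
    among all odd closed walks, not just cycles. *)
Record shortest_odd_cycle G c N : Prop := ShortestOddCycle {
  soc_odd : odd N;
  soc_adj : forall i, adj G (c i) (c i.+1);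
  soc_periodic : forall i, c (i + N) = c i;
  soc_shortest : forall x p, odd_closed_walk G x p -> N <= size p }.

Lemma exists_shortest_odd_cycle G x p : odd_closed_walk G x p ->
  exists c N, shortest_odd_cycle G c N.
Proof.
move=> xp0; pose P n := `[< exists y q, odd_closed_walk G y q /\ size q = n >].
have exP : exists n, P n by exists (size p); apply/asboolP; exists x, p.
case: (ex_minnP exP) => N /asboolP[y [q [[yq yq_last odd_q] <-]]] min_q.
have q_gt0 : 0 < size q by case: (q) odd_q.
exists (fun i => nth y (y :: q) (i %% size q)), (size q); split=> //.
- move=> i; have ltr : i %% size q < size q by rewrite ltn_mod.
  have -> : nth y (y :: q) (i.+1 %% size q) = nth y q (i %% size q).
    rewrite -addn1 -modnDml addn1.
    have := ltr; rewrite leq_eqVlt => /predU1P[ltE|lt1].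
      rewrite ltE modnn (_ : i %% size q = (size q).-1) ?nth_last ?yq_last //.
      by rewrite -[in RHS]ltE.
    by rewrite modn_small.
  exact: (pathP y yq).
- by move=> i; rewrite modnDr.
- by move=> z s zs; apply: min_q; apply/asboolP; exists z, s.
Qed.

Lemma shift_shortest_odd_cycle G c N :
  shortest_odd_cycle G c N -> shortest_odd_cycle G (fun i => c i.+1) N.
Proof.
by case=> odd_N adj_c per_c min_N; split=> // i; rewrite -addSn per_c.
Qed.

Definition walk_arc c a l := [seq c i | i <- iota a.+1 l].

Lemma size_walk_arc c a l : size (walk_arc c a l) = l.
Proof. by rewrite size_map size_iota. Qed.

Lemma walk_arcS c a l : walk_arc c a l.+1 = rcons (walk_arc c a l) (c (a + l.+1)).
Proof. by rewrite /walk_arc -{1}[l.+1]addn1 iotaD map_cat /= cats1 addSnnS. Qed.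

Lemma last_walk_arc c a l : last (c a) (walk_arc c a l) = c (a + l).
Proof. by case: l => [|l]; rewrite ?addn0 // walk_arcS last_rcons. Qed.

Lemma path_walk_arc G c a l : (forall i, adj G (c i) (c i.+1)) ->
  path (adj G) (c a) (walk_arc c a l).
Proof.
move=> adj_c; elim: l => // l IH.
by rewrite walk_arcS rcons_path IH last_walk_arc addnS adj_c.
Qed.

Section Facts.
Variables (G : sgraph V) (c : nat -> V) (N : nat).
Hypothesis soc : shortest_odd_cycle G c N.

Definition on_cycle : pred V := [pred z | z \in [seq c i | i <- iota 0 N]].

Lemma soc_ge3 : 3 <= N.
Proof.
have := soc_odd soc; case: N (soc_periodic soc) => [|[|[|n]]] // per _.
by have := soc_adj soc 0; rewrite -[1]/(0 + 1) per adj_irr.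
Qed.

Lemma cycle_mod i : c i = c (i %% N).
Proof.
rewrite {1}(divn_eq i N) addnC; elim: (i %/ N) => [|k IH]; first by rewrite addn0.
by rewrite mulSn [N + _]addnC addnA (soc_periodic soc).
Qed.

Lemma on_cycleP z : reflect (exists2 i, i < N & z = c i) (on_cycle z).
Proof.
apply: (iffP mapP) => -[i]; rewrite ?mem_iota => iN ->; exists i => //.
by rewrite mem_iota.
Qed.

Lemma on_cycle_c i : on_cycle (c i).
Proof.
apply/on_cycleP; exists (i %% N); last exact: cycle_mod.
by rewrite ltn_mod (leq_trans _ soc_ge3).
Qed.

Lemma walk_arc_on_cycle a l z : z \in walk_arc c a l -> on_cycle z.
Proof. by move=> /mapP[i _ ->]; apply: on_cycle_c. Qed.

Lemma shortest_chord a l : adj G (c a) (c (a + l)) -> ~~ odd l -> N <= l.+1.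
Proof.
move=> chord el; have := soc_shortest soc (x := c a) (p := rcons (walk_arc c a l) (c a)).
rewrite size_rcons size_walk_arc; apply; split; rewrite ?last_rcons ?size_rcons ?size_walk_arc //=.
by rewrite rcons_path path_walk_arc ?last_walk_arc 1?adj_sym //; apply: soc_adj soc.
Qed.

Lemma shortest_detour a l t : adj G (c a) t -> adj G t (c (a + l)) -> odd l ->
  N <= l.+2.
Proof.
move=> at_ tl ol.
have := soc_shortest soc (x := c a) (p := rcons (rcons (walk_arc c a l) t) (c a)).
rewrite !size_rcons size_walk_arc; apply; split; rewrite ?last_rcons ?size_rcons ?size_walk_arc //= ?negbK //.
rewrite !rcons_path path_walk_arc ?last_walk_arc ?last_rcons ?[adj G _ t]adj_sym ?tl ?[adj G t _]adj_sym //.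
exact: soc_adj soc.
Qed.

(** A repeated vertex would cut the cycle into two closed walks, one of which is
    odd and shorter. *)
Lemma cycle_simple a l : 0 < l < N -> c (a + l) != c a.
Proof.
move=> /andP[l0 lN]; apply/negP => /eqP cc; have adj_c := soc_adj soc.
have [ol|el] := boolP (odd l).
  have := soc_shortest soc (x := c a) (p := walk_arc c a l); rewrite size_walk_arc.
  rewrite leqNgt lN => H; suff : false by []. apply: H.
  by split; rewrite ?size_walk_arc ?last_walk_arc //; apply: path_walk_arc.
have := soc_shortest soc (x := c (a + l)) (p := walk_arc c (a + l) (N - l)); rewrite size_walk_arc.
have -> : (N <= N - l) = false by apply/negbTE; rewrite -ltnNge; move: l0 lN; clear; lia.
move=> H; suff : false by []. apply: H.
split; rewrite ?size_walk_arc ?last_walk_arc //; first exact: path_walk_arc.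
  by rewrite -addnA subnKC 1?ltnW // (soc_periodic soc) cc.
by rewrite oddB 1?ltnW // (soc_odd soc) (negbTE el).
Qed.

End Facts.

(** An odd closed walk avoiding c_0 contains a piece from a cycle vertex c_j to
    a cycle vertex c_i, with interior off the cycle, whose parity is not
    that of j - i; say i <= j. So it has the parity of the arc from c_j to
    c_i through c_0. If both are odd, c_i and c_j are adjacent, which is
    absurd for i = j and otherwise yields a shorter odd cycle. If both are
    even, the last interior vertex t of the piece is adjacent to c_j too,
    and the detour through t gives a shorter odd cycle unless i = 1 and j =
    N - 1. *)
Lemma twin G c N : exchange G -> shortest_odd_cycle G c N ->
  connected (delv G (c 0)) -> (exists x p, odd_closed_walk (delv G (c 0)) x p) ->
  exists t, [/\ ~~ on_cycle c N t, adj G (c 1) t & adj G t (c N.-1)].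
Proof.
move=> exG soc conG [z [d zd]].
have N3 := soc_ge3 soc; have odd_N := soc_odd soc; have adj_c := soc_adj soc.
have c1G : c 1 \in vset (delv G (c 0)).
  by rewrite vset_delv !inE (adj_vsetr (adj_c 0)) eq_sym (adj_neq (adj_c 0)).
have [s [c1s last_s odd_s]] := odd_closed_walk_at conG c1G zd.
pose idx z := index z [seq c i | i <- iota 0 N].
have idx_lt x : on_cycle c N x -> idx x < N.
  by rewrite -{2}(size_iota 0 N) -(size_map c) index_mem.
have idxK x : on_cycle c N x -> c (idx x) = x.
  move=> cx; rewrite -[RHS](nth_index (c 0) cx) (nth_map 0).
    by rewrite nth_iota ?add0n //; apply: idx_lt.
  by rewrite size_iota; apply: idx_lt.
have idx_gt0 x : on_cycle c N x -> x != c 0 -> 0 < idx x.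
  by move=> /idxK xE; rewrite lt0n; apply: contraNneq => x0; rewrite -xE x0.
have [|||x [q [y [xq cx cy cq par]]]] := unbalanced_ear (T := on_cycle c N) (col := odd \o idx) c1s.
- exact: on_cycle_c soc 1.
- by rewrite last_s; apply: on_cycle_c soc 1.
- by rewrite last_s odd_s -addbA addbb.
have ear j i r : 0 < i <= j -> j < N -> path (adj G) (c j) (rcons r (c i)) ->
    c 0 \notin r -> all (predC (on_cycle c N)) r -> odd (size r).+1 (+) odd j (+) odd i ->
    exists t, [/\ ~~ on_cycle c N t, adj G (c 1) t & adj G t (c N.-1)].
  move=> /andP[i0 ij] jN jr c0r offr; rewrite /= => parr.
  have off w : w \in r -> ~~ on_cycle c N w by move/(allP offr).
  have arcE : c (j + (N + i - j)) = c i.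
    by rewrite subnKC 1?addnC ?(soc_periodic soc) //; move: jN; clear; lia.
  have [or|er] := boolP (odd (size r)).
    case/lastP: r jr c0r offr parr off or => // r t.
    rewrite rcons_path last_rcons size_rcons /= => /andP[jt ti] c0r _ parr off er.
    have par2 : odd (j - i).
      rewrite oddB //; move: parr er.
      by case: (odd (size r)); case: (odd j); case: (odd i).
    have jt_adj : adj G (c j) t.
      apply: (two_odd_walks_adj exG jt (q := walk_arc c j (N + i - j))).
      - rewrite rcons_path path_walk_arc // last_walk_arc arcE adj_sym; exact: ti.
      - exact: er.
      - rewrite size_walk_arc oddB ?oddD ?odd_N; last by move: jN; clear; lia.
        by move: par2; rewrite oddB //; case: (odd j); case: (odd i).
      - move=> w wr; apply: contraTN (off w _); last by rewrite mem_rcons inE wr orbT.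
        by move=> /(walk_arc_on_cycle soc) ->.
    have := shortest_detour soc (a := i) (l := j - i) (t := t).
    rewrite subnKC // => /(_ _ _ par2) detour.
    have [i1 jN1] : i = 1 /\ j = N.-1.
      have := detour; rewrite adj_sym ti adj_sym jt_adj => /(_ isT isT).
      by move: i0 ij jN; clear; lia.
    exists t; split; first by apply: off; rewrite mem_rcons inE eqxx.
      by rewrite -i1 adj_sym.
    by rewrite -jN1 adj_sym.
  have par2 : ~~ odd (j - i).
    rewrite oddB //; move: parr; rewrite er.
    by case: (odd j); case: (odd i).
  have ji_adj : adj G (c j) (c i).
    apply: (two_odd_walks_adj exG jr (q := walk_arc c j (N + i - j).-1)) => //.
    - have := path_walk_arc j (N + i - j) adj_c.
      by rewrite -(@prednK (N + i - j)) ?walk_arcS ?prednK ?arcE //; move: jN; clear; lia.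
    - rewrite size_walk_arc -subn1 !oddB ?oddD ?odd_N /=; try by move: i0 jN; clear; lia.
      by move: par2; rewrite oddB //; case: (odd j); case: (odd i).
    - by move=> w /off; apply: contraNN => /(walk_arc_on_cycle soc).
  have := shortest_chord soc (a := i) (l := j - i); rewrite subnKC // adj_sym ji_adj.
  by move=> /(_ isT par2); move: i0 ij jN; clear; lia.
have [xqG] := delv_path xq; rewrite mem_rcons inE negb_or => /andP[c0y c0q].
have x0 : x != c 0.
  by case: q xq {xqG cq par c0q} => [|u q] /=; rewrite adj_delv => /andP[/and3P[]].
have y0 : y != c 0 by rewrite eq_sym.
have [le|lt] := leqP (idx y) (idx x).
  apply: (ear (idx x) (idx y) q); rewrite ?idxK ?idx_lt ?idx_gt0 //.
apply: (ear (idx y) (idx x) (rev q)); rewrite ?idxK ?idx_lt ?idx_gt0 ?all_rev ?mem_rev //.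
- by rewrite ltnW.
- by apply: rev_walk xqG; apply: adj_sym.
- by rewrite size_rev addbAC.
Qed.

Definition clique4 G (K : {set V}) :=
  [/\ K \subset vset G, #|K| = 4 & {in K &, forall x y, x != y -> adj G x y}].

(** Let t and t' be twins of c_0 and c_1. In a cycle of length at least 5, the
    vertices c_(N-1), c_0, t', c_2, c_1, t form a hexagon, whose opposite
    vertices c_(N-1) and c_2 are adjacent: this gives a shorter odd cycle.
    For a triangle, t = t', since otherwise two triangles would share only
    the vertex c_2. *)
Lemma two_twins_clique4 G c N : exchange G -> two_connected G ->
  shortest_odd_cycle G c N ->
  (exists x p, odd_closed_walk (delv G (c 0)) x p) ->
  (exists x p, odd_closed_walk (delv G (c 1)) x p) ->
  exists K, clique4 G K.
Proof.
move=> exG [conG delG] soc odd0 odd1.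
have adj_c := soc_adj soc; have N3 := soc_ge3 soc.
have vc i : c i \in vset G by apply: adj_vsetl (adj_c i).
have [t [offt c1t tcN]] := twin exG soc (delG _ (vc 0)) odd0.
have soc' := shift_shortest_odd_cycle soc.
have [t' [offt' c2t' t'c0]] := twin exG soc' (delG _ (vc 1)) odd1.
have cN : c N = c 0 by rewrite -(soc_periodic soc 0).
have {t'c0} t'c0 : adj G t' (c 0) by move: t'c0; rewrite /= prednK ?cN // (leq_trans _ N3).
have {offt'} offt' : ~~ on_cycle c N t'.
  apply: contraNN offt' => /on_cycleP[i iN tE]; rewrite tE.
  have -> : c i = c (i + N).-1.+1 by rewrite prednK ?(soc_periodic soc) //; move: N3; clear; lia.
  exact: (on_cycle_c soc').
have offc i z : ~~ on_cycle c N z -> z != c i.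
  by apply: contraNneq => ->; apply: (on_cycle_c soc).
have [N_eq3|N_gt3] := eqVneq N 3.
  rewrite N_eq3 /= in tcN cN.
  have [ttE|tt'] := eqVneq t t'; last first.
    have /negP[] := negbT (adj_irr G (c 2)).
    apply: (two_odd_walks_adj exG (p := [:: c 1; t]) (q := [:: c 0; t'])) => //=.
    - by rewrite adj_sym adj_c c1t tcN.
    - by rewrite -{1}cN adj_c [adj G (c 0) t']adj_sym t'c0 adj_sym c2t'.
    move=> z; rewrite !inE => /orP[]/eqP->; rewrite negb_or.
      by rewrite eq_sym (adj_neq (adj_c 0)) eq_sym offc.
    by rewrite offc.
  have tc i : adj G t (c (i %% 3)).
    have : i %% 3 < 3 by rewrite ltn_mod.
    by case: (i %% 3) => [|[|[|]]] //; rewrite ?ttE // -?ttE adj_sym.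
  have neq i j : i < 3 -> j < 3 -> i != j -> c i != c j.
    wlog ij : i j / i < j => [W i3 j3|i3 j3 _].
      by rewrite neq_ltn => /orP[] lt; [|rewrite eq_sym]; apply: W; rewrite // neq_ltn lt ?orbT.
    rewrite eq_sym -(subnKC (ltnW ij)); apply: (cycle_simple soc).
    by rewrite N_eq3; move: ij j3; clear; lia.
  have adjc i j : i < 3 -> j < 3 -> i != j -> adj G (c i) (c j).
    wlog ij : i j / i < j => [W i3 j3|i3 j3 _].
      by rewrite neq_ltn => /orP[] lt; [|rewrite adj_sym]; apply: W; rewrite // neq_ltn lt ?orbT.
    by case: i j ij i3 j3 => [|[|i]] [|[|[|j]]] // _ _ _; rewrite ?adj_c // -cN adj_sym adj_c.
  exists (t |: [set c 0; c 1; c 2]); split.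
  - by apply/subsetP => z; rewrite !inE -!orbA => /or4P[]/eqP-> //; apply: adj_vsetr c1t.
  - by rewrite cardsU1 !inE !negb_or !offc // -setUA cardsU1 !inE negb_or cards2 !neq.
  move=> x y; rewrite !inE -!orbA => /or4P[]/eqP-> /or4P[]/eqP->; rewrite ?eqxx // => _;
    by rewrite ?adjc ?(tc 0) ?(tc 1) ?(tc 2) // adj_sym ?(tc 0) ?(tc 1) ?(tc 2).
exfalso.
have odd_N := soc_odd soc; have N5 : 5 <= N.
  by move: odd_N N3 N_gt3; case: (N) => [|[|[|[|[|n]]]]].
have tt' : t != t'.
  apply/negP => /eqP tE; have := shortest_detour soc (a := 0) (l := 1) (t := t).
  rewrite add0n [adj G t _]adj_sym c1t tE adj_sym t'c0 => /(_ isT isT isT).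
  by move: N5; clear; lia.
have cNc0 : adj G (c N.-1) (c 0) by rewrite -cN -{2}(prednK (leq_trans _ N3)).
have : adj G (c N.-1) (c 2).
  apply: (two_odd_walks_adj exG (p := [:: c 0; t']) (q := [:: t; c 1])) => //=.
  - by rewrite cNc0 adj_sym t'c0 adj_sym c2t'.
  - by rewrite adj_sym tcN adj_sym c1t adj_c.
  move=> z; rewrite !inE => /orP[]/eqP->; rewrite negb_or.
    by rewrite eq_sym offc // (adj_neq (adj_c 0)).
  by rewrite eq_sym tt' offc.
have := shortest_chord soc (a := 2) (l := N - 3).
rewrite (_ : 2 + (N - 3) = N.-1); last by move: N5; clear; lia.
rewrite adj_sym => chord /chord; rewrite oddB // odd_N => /(_ isT).
by move: N5; clear; lia.
Qed.

End ShortestOddCycle.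

(** * Blocks of a graph with the exchange property *)

Section Blocks.
Variable V : finType.
Implicit Types (G H : sgraph V) (x y z v t : V) (p q : seq V) (c : nat -> V).

(** A further vertex would give a path q outside the clique between two of its
    vertices k1 and k2. If q has an odd number of vertices, it closes up
    with k2 to an odd cycle meeting the triangle k1 k3 k4 only in k1. If
    that number is even, the first vertex z of q is adjacent to k3, and the
    triangles k1 z k3 and k1 k2 k4 share only k1. *)
Lemma clique4_is_K4 G K : exchange G -> two_connected G -> clique4 G K -> is_K4 G.
Proof.
move=> exG [conG delG] [KG cardK fullK].
suff KE : vset G = K by split; rewrite KE.
apply/eqP; rewrite eqEsubset KG andbT; apply/negPn/negP => /subsetPn[z0 z0G z0K].
have more k : k \in K -> exists2 k', k' \in K & k' != k.
  move=> kK; have : 0 < #|K :\ k| by move: cardK; rewrite (cardsD1 k) kK add1n => -[->].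
  by move=> /card_gt0P[k']; rewrite !inE => /andP[? ?]; exists k'.
have [z [k1 [zG zK k1K zk1]]] :
    exists z k1, [/\ z \in vset G, z \notin K, k1 \in K & adj G z k1].
  have [k kK] : exists k, k \in K by apply/card_gt0P; rewrite cardK.
  have /connectP[p zp kE] := conG _ _ z0G (subsetP KG _ kK).
  have hasp : has (mem K) p.
    case: p zp kE => [_ /= kE|u p _ kE]; first by rewrite -kE kK in z0K.
    by apply/hasP; exists (last u p); rewrite ?mem_last // -[last u p]kE.
  have [q [y [zq yK qK]]] := first_hit zp hasp.
  move: zq; rewrite rcons_path => /andP[_ qy].
  exists (last z0 q), y; split=> //; first exact: adj_vsetl qy.
  by have := mem_last z0 q; rewrite inE => /predU1P[->//|/(allP qK)].
have [k' k'K k'k1] := more k1 k1K.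
have [||p zp k'E] := connectP (delG k1 (subsetP KG _ k1K) z k' _ _).
- by rewrite vset_delv !inE zG (adj_neq zk1).
- by rewrite vset_delv !inE k'k1 (subsetP KG).
have hasp : has (mem K) p.
  case: p zp k'E => [_ /= zE|u p _ k'E]; first by rewrite -zE k'K in zK.
  by apply/hasP; exists (last u p); rewrite ?mem_last // -[last u p]k'E.
have [q [k2 [zq k2K qK]]] := first_hit zp hasp; have {}k2K : k2 \in K by [].
have [zqG] := delv_path zq; rewrite mem_rcons inE negb_or => /andP[k12 k1q].
have [k3 [k4 [k34 KE]]] : exists k3 k4, k3 != k4 /\ K :\ k1 :\ k2 = [set k3; k4].
  apply/cards2P; move: cardK; rewrite (cardsD1 k1) k1K (cardsD1 k2) !inE k2K eq_sym k12.
  by rewrite !add1n => -[->].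
have [k3K k31 k32] : [/\ k3 \in K, k3 != k1 & k3 != k2].
  have : k3 \in K :\ k1 :\ k2 by rewrite KE !inE eqxx.
  by rewrite !inE => /and3P[].
have [k4K k41 k42] : [/\ k4 \in K, k4 != k1 & k4 != k2].
  have : k4 \in K :\ k1 :\ k2 by rewrite KE !inE eqxx orbT.
  by rewrite !inE => /and3P[].
have off w : w \in z :: q -> w \notin K.
  by rewrite inE => /predU1P[->//|/(allP qK)].
have offk w k : w \in z :: q -> k \in K -> w != k.
  by move=> /off wK kK; apply: contraNneq wK => ->.
have k1z : adj G k1 z by rewrite adj_sym.
have adjK := fullK.
have [oq|eq_] := boolP (odd (size (z :: q))).
  suff : adj G k1 k1 by rewrite adj_irr.
  apply: (two_odd_walks_adj exG (p := rcons (z :: q) k2) (q := [:: k3; k4])) => //.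
  - by rewrite rcons_path last_rcons [path _ _ _]/= k1z zqG adjK // eq_sym.
  - by rewrite /= !adjK // eq_sym.
  - by rewrite size_rcons /= negbK.
  move=> w; rewrite mem_rcons inE => /predU1P[->|wq]; rewrite !inE negb_or.
    by rewrite ![k2 == _]eq_sym k32.
  by rewrite !offk.
have k3z : adj G k3 z.
  apply: (two_odd_walks_adj exG (p := [:: k4; k1]) (q := k2 :: rev q)) => //.
  - by rewrite /= k1z !adjK.
  - rewrite rcons_cons [path _ _ _]/= adjK //=.
    by apply: rev_walk zqG; apply: adj_sym.
  - by rewrite /= size_rev.
  move=> w; rewrite !inE mem_rev => /orP[]/eqP->; rewrite negb_or ?k42 ?k12 ?k1q //.
  by apply/negP => k4q; have := off k4; rewrite inE k4q orbT k4K => /(_ isT).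
suff : adj G k1 k1 by rewrite adj_irr.
apply: (two_odd_walks_adj exG (p := [:: z; k3]) (q := [:: k2; k4])) => //=.
- by rewrite k1z adj_sym k3z adjK.
- by rewrite !adjK // eq_sym.
move=> w; rewrite !inE => /orP[]/eqP->; rewrite negb_or ?k32 //.
by rewrite !offk // inE eqxx.
Qed.

Lemma adj_subgraph H G : subgraph H G -> subrel (adj H) (adj G).
Proof. by move=> /andP[_ /subsetP sub] x y; apply: sub. Qed.

Lemma two_connected_more_edges H H' : vset H = vset H' -> subrel (adj H) (adj H') ->
  two_connected H -> two_connected H'.
Proof.
move=> vE sub [conH delH]; split=> [x y|v].
  rewrite -vE => xH yH; apply: connect_sub (conH _ _ xH yH) => a b ab.
  exact/connect1/sub.
rewrite -vE => vH x y; rewrite !vset_delv -vE -vset_delv => xH yH.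
apply: connect_sub (delH _ vH _ _ xH yH) => a b; rewrite adj_delv => /and3P[ab av bv].
by apply: connect1; rewrite adj_delv sub ?av.
Qed.

Lemma block_induced G H : two_connected_component G H -> H = induced G (vset H).
Proof.
case=> subHG twoH maxH; apply/esym/maxH; first exact: sub_induced.
- apply: two_connected_more_edges twoH.
    by apply/esym/setIidPr; case/andP: subHG.
  move=> x y xy; rewrite adj_induced (adj_subgraph subHG xy).
  by rewrite (adj_vsetl xy) (adj_vsetr xy).
case/andP: subHG => sV sE; rewrite /subgraph /= (setIidPr sV) subxx /=.
apply/subsetP => e eH; rewrite inE (subsetP sE _ eH) /=.
exact: edge_sub eH.
Qed.

Lemma block_exchange G H : exchange G -> two_connected_component G H -> exchange H.
Proof. by move=> exG /block_induced->; apply: exchange_induced. Qed.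

Lemma exists_block G H0 : subgraph H0 G -> two_connected H0 ->
  exists2 H, two_connected_component G H & subgraph H0 H.
Proof.
have [n] := ubnP (#|vset G| + #|eset G| - (#|vset H0| + #|eset H0|)).
elim: n H0 => // n IH H0 lt sub0 two0.
have [maxH|] := pselect (two_connected_component G H0).
  by exists H0; rewrite // /subgraph !subxx.
move=> notmax.
have [H [subH twoH sub0H HH0]] : exists H, [/\ subgraph H G, two_connected H,
    subgraph H0 H & H <> H0].
  apply: contrapT => none; apply: notmax; split=> // H subH twoH sub0H.
  by apply: contrapT => HH0; apply: none; exists H.
have [|H' compH' subH'] := IH H _ subH twoH; last first.
  exists H' => //; case/andP: sub0H subH' => v1 e1 /andP[v2 e2].
  by rewrite /subgraph (subset_trans v1) // (subset_trans e1).
case/andP: subH => vHG eHG; case/andP: sub0H => v0H e0H.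
have lev := subset_leq_card vHG; have lee := subset_leq_card eHG.
have lev0 := subset_leq_card v0H; have lee0 := subset_leq_card e0H.
have : (#|vset H0| < #|vset H|) || (#|eset H0| < #|eset H|).
  rewrite !ltnNge -negb_and; apply/negP => /andP[vle ele]; apply: HH0.
  by apply: sgraph_eq; apply/eqP; rewrite eq_sym eqEcard ?v0H ?e0H.
by move: lt lev lee lev0 lee0; clear; lia.
Qed.

(** Of the two common vertices at least one survives the deletion of any vertex. *)
Lemma two_connected_union G H1 H2 x y : subgraph H1 G -> subgraph H2 G ->
  two_connected H1 -> two_connected H2 -> x != y ->
  x \in vset H1 :&: vset H2 -> y \in vset H1 :&: vset H2 ->
  two_connected (induced G (vset H1 :|: vset H2)).
Proof.
move=> sub1 sub2 [con1 del1] [con2 del2] xy; rewrite !inE => /andP[x1 x2] /andP[y1 y2].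
set H := induced G _.
have subv : vset H = vset H1 :|: vset H2.
  by apply/setIidPr; rewrite subUset; case/andP: sub1 => ->; case/andP: sub2 => ->.
have up1 : subrel (adj H1) (adj H).
  move=> a b ab; rewrite adj_induced (adj_subgraph sub1 ab) !inE.
  by rewrite (adj_vsetl ab) (adj_vsetr ab).
have up2 : subrel (adj H2) (adj H).
  move=> a b ab; rewrite adj_induced (adj_subgraph sub2 ab) !inE.
  by rewrite (adj_vsetl ab) (adj_vsetr ab) !orbT.
have glue (e : rel V) (A1 A2 : {set V}) s : symmetric e ->
    (forall a, a \in A1 -> connect e a s) -> (forall a, a \in A2 -> connect e a s) ->
    {in A1 :|: A2 &, forall a b, connect e a b}.
  move=> e_sym conn1 conn2 a b.
  have conn u : u \in A1 :|: A2 -> connect e u s by rewrite inE => /orP[/conn1|/conn2].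
  by move=> /conn aA /conn bA; apply: connect_trans aA _; rewrite sym_connect_sym.
have lift (H' : sgraph V) (e e' : rel V) s : subrel e e' ->
    {in vset H' &, forall a b, connect e a b} -> s \in vset H' ->
    forall a, a \in vset H' -> connect e' a s.
  move=> sube conn sH' a aH'; apply: connect_sub (conn _ _ aH' sH').
  by move=> u w /sube/connect1.
split; rewrite /connected.
  rewrite subv; apply: (glue _ _ _ x); first exact: adj_sym.
    exact: (lift H1 (adj H1)).
  exact: (lift H2 (adj H2)).
move=> v vH; have [s [sv s1 s2]] : exists s, [/\ s != v, s \in vset H1 & s \in vset H2].
  by have [xv|xv] := eqVneq x v; [exists y; rewrite -xv eq_sym | exists x].
have updel (H' : sgraph V) : subrel (adj H') (adj H) -> subrel (adj (delv H' v)) (adj (delv H v)).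
  by move=> up a b; rewrite !adj_delv => /and3P[/up-> -> ->].
have del (H' : sgraph V) : two_connected H' -> subrel (adj H') (adj H) -> s \in vset H' ->
    forall a, a \in vset H' :\ v -> connect (adj (delv H v)) a s.
  move=> [con' del'] up sH' a aH'; have [vH'|vH'] := boolP (v \in vset H').
    apply: (lift (delv H' v) (adj (delv H' v))) => //; first exact: updel.
    - exact: del'.
    - by rewrite vset_delv !inE sv.
    - by rewrite vset_delv.
  apply: (lift H' (adj H')) => //; last by move: aH'; rewrite !inE => /andP[].
  move=> u w uw; rewrite adj_delv up //=; apply/andP; split.
    by apply: contraNneq vH' => <-; apply: adj_vsetl uw.
  by apply: contraNneq vH' => <-; apply: adj_vsetr uw.
rewrite vset_delv subv setDUl; apply: (glue _ _ _ s); first exact: adj_sym.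
  exact: del.
exact: del.
Qed.

Lemma blocks_meet_in_one G H1 H2 : two_connected_component G H1 ->
  two_connected_component G H2 -> H1 <> H2 ->
  {in vset H1 :&: vset H2 &, forall x y, x = y}.
Proof.
move=> [sub1 two1 max1] [sub2 two2 max2] H12 x y xI yI; apply/eqP/negP => /negP xy.
have twoU := two_connected_union sub1 sub2 two1 two2 xy xI yI.
have subU := sub_induced G (vset H1 :|: vset H2).
have sub_of H : subgraph H G -> vset H \subset vset H1 :|: vset H2 ->
    subgraph H (induced G (vset H1 :|: vset H2)).
  move=> /andP[sV sE] sU; rewrite /subgraph /= subsetI sV sU /=.
  apply/subsetP => e eH; rewrite inE (subsetP sE _ eH) subsetI.
  by rewrite !(subset_trans (edge_sub eH)).
apply: H12; apply: etrans (esym (max1 _ subU twoU _)) (max2 _ subU twoU _).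
  by apply: sub_of; rewrite ?subsetUl.
by apply: sub_of; rewrite ?subsetUr.
Qed.

Lemma walk_vset G x p : path (adj G) x p -> {subset p <= vset G}.
Proof.
elim: p x => //= u p IH x /andP[xu /IH sub] w; rewrite inE => /predU1P[->|/sub//].
exact: adj_vsetr xu.
Qed.

(** Take a shortest odd cycle in the first block. The second block contains at
    most one of its vertices. An odd closed walk of the second block is
    based at this vertex, or else connected to the cycle by a path up to the
    first hit, so that it becomes an odd closed walk at a vertex of the
    cycle which meets the cycle nowhere else. *)
Lemma odd_blocks_eq G H1 H2 : exchange G -> connected G ->
  two_connected_component G H1 -> two_connected_component G H2 ->
  ~ colourable H1 -> ~ colourable H2 -> H1 = H2.
Proof.
move=> exG conG comp1 comp2 odd1 odd2; apply: contrapT => H12.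
have meet1 := blocks_meet_in_one comp1 comp2 H12.
have [sub1 [con1 _] _] := comp1; have [sub2 [con2 _] _] := comp2.
have odd_walk H : connected H -> ~ colourable H -> exists x p, odd_closed_walk H x p.
  move=> conH nc; apply: contrapT => none; apply: nc.
  by apply: colourable_of_odd_closed_walk_free => // x p xp; apply: none; exists x, p.
have [x1 [p1 walk1]] := odd_walk _ con1 odd1.
have [x2 [p2 walk2]] := odd_walk _ con2 odd2.
have [c [N soc]] := exists_shortest_odd_cycle walk1.
have adj_c := soc_adj soc; have N3 := soc_ge3 soc; have odd_N := soc_odd soc.
have adj1 i : adj G (c i) (c i.+1) by apply: adj_subgraph sub1 _ _ _.
have c1 i : c i \in vset H1 by apply: adj_vsetl (adj_c i).
suff [i [p [ip ep offp]]] : exists i p, [/\ path (adj G) (c i) (rcons p (c i)),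
    ~~ odd (size p) & forall w, w \in p -> on_cycle c N w -> w = c i].
  suff : adj G (c i) (c i) by rewrite adj_irr.
  apply: (two_odd_walks_adj exG ip (q := walk_arc c i N.-1)) => //.
  - have := path_walk_arc i N adj1; rewrite -{1}(prednK (leq_trans _ N3)) // walk_arcS.
    by rewrite prednK ?(leq_trans _ N3) // (soc_periodic soc).
  - by rewrite size_walk_arc -subn1 oddB ?(leq_trans _ N3) // odd_N.
  move=> w /offp wi; apply/negP => wa; have {wi} wi := wi (walk_arc_on_cycle soc wa).
  move: wa => /mapP[m]; rewrite mem_iota => /andP[im mN] wE.
  have mi : 0 < m - i < N by move: im mN N3; clear; lia.
  by have := cycle_simple soc i mi; rewrite subnKC ?(ltnW im) // -wE wi eqxx.
have [hit|nohit] := pselect (exists i, c i \in vset H2).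
  case: hit => i ci; have [d [cd last_d odd_d]] := odd_closed_walk_at con2 ci walk2.
  case/lastP: d cd last_d odd_d => // d y cd; rewrite last_rcons => yE; subst y.
  rewrite size_rcons /= => ed; exists i, d; split=> //.
    exact: sub_path (adj_subgraph sub2) _ _ cd.
  move=> w wd /on_cycleP[j _ wE]; apply: meet1; rewrite inE ?c1 ?ci // wE c1 /= -wE.
  by rewrite (walk_vset cd) // mem_rcons inE wd orbT.
have x2H : x2 \in vset H2.
  by case: walk2; case: p2 => //= u p2 /andP[/adj_vsetl].
have off2 w : w \in vset H2 -> ~~ on_cycle c N w.
  by move=> wH; apply/on_cycleP => -[i _ wE]; apply: nohit; exists i; rewrite -wE.
have c0G : c 0 \in vset G by apply: adj_vsetl (adj1 0).
have x2G : x2 \in vset G by case/andP: sub2 => /subsetP/(_ _ x2H).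
have /connectP[p xp c0E] := conG _ _ x2G c0G.
have hasp : has (on_cycle c N) p.
  case: p xp c0E => [_ /= c0E|u p _ c0E].
    by have := off2 _ x2H; rewrite -c0E (on_cycle_c soc).
  by apply/hasP; exists (last u p); rewrite ?mem_last // -[last u p]c0E (on_cycle_c soc).
have [q [y [xq /on_cycleP[i _ yE] offq]]] := first_hit xp hasp.
subst y; have [d2 last2 odd2'] := walk2.
exists i, (rcons (rev q) x2 ++ p2 ++ q); split.
- rewrite !rcons_cat !cat_path last_rcons last2.
  rewrite (rev_walk _ xq) ?xq ?andbT /=; last exact: adj_sym.
  exact: sub_path (adj_subgraph sub2) _ _ d2.
- rewrite !size_cat size_rcons size_rev addnCA addSn oddD /= addnn odd2'.
  by rewrite odd_double.
move=> w; rewrite !mem_cat mem_rcons inE mem_rev => /or3P[/predU1P[->|wq]|wp|wq] wc.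
- by move: (off2 _ x2H); rewrite wc.
- by move: (allP offq _ wq); rewrite /= wc.
- by move: (off2 _ (walk_vset d2 wp)); rewrite wc.
- by move: (allP offq _ wq); rewrite /= wc.
Qed.

Lemma delv_colourable_bipartition G v : colourable (delv G v) ->
  exists V1 V2, bipartition (delv G v) V1 V2.
Proof. by move=> [col /colouring_bipartition]; eexists; eexists; eassumption. Qed.

Lemma colourable_subgraph H G : subgraph H G -> colourable G -> colourable H.
Proof. by move=> sub [col colG]; exists col => x y /(adj_subgraph sub)/colG. Qed.

Lemma path_delv G v x p : path (adj G) x p -> (forall w, w \in x :: p -> w != v) ->
  path (adj (delv G v)) x p.
Proof.
elim: p x => //= u s IH x /andP[xu us] offv.
rewrite adj_delv xu !offv ?inE ?eqxx ?orbT //=; apply: IH => // w ws.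
by apply: offv; rewrite inE ws orbT.
Qed.

Lemma meets_odd_cycles_of_free G v : v \in vset G -> 
  (forall x p, ~ odd_closed_walk (delv G v) x p) -> meets_odd_cycles G v.
Proof.
move=> vG free; split=> // -[|x p] [//= size_c odd_c /andP[cyc _]].
apply/negPn/negP; rewrite inE negb_or => /andP[vx vp].
apply: (free x (rcons p x)); split; rewrite ?last_rcons ?size_rcons //.
have offv w : w \in x :: rcons p x -> w != v.
  rewrite !(inE, mem_rcons) => /or3P[/eqP->|/eqP->|wp]; rewrite 1?eq_sym //.
  by apply: contraNneq vp => ->.
exact: path_delv offv.
Qed.

End Blocks.

Section Classification.
Variable V : finType.
Implicit Types (G H : sgraph V).

Lemma exchange_split_type G v : exchange G -> two_connected G -> v \in vset G ->
  (forall x p, ~ odd_closed_walk (delv G v) x p) -> split_type G.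
Proof.
move=> exG [_ delG] vG free.
have [V1 [V2 bip]] := delv_colourable_bipartition
  (colourable_of_odd_closed_walk_free (delG v vG) free).
exists v, V1, V2; split=> //; first exact: meets_odd_cycles_of_free.
have exS := exchange_iso (split_iso vG bip) exG.
move=> B compB; have [subB twoB _] := compB.
apply: two_connected_complete_bipartite => //; first exact: block_exchange compB.
apply: colourable_subgraph subB _; exists (split_colour V1); exact: split_colouring.
Qed.

(** A non-bipartite block becomes the special one; when there is none, any block
    will do. *)
Lemma exchange_classification G : exchange G -> connected G ->
  exists Gs : sgraph V,
    [/\ two_connected_component G Gs,
        forall H, two_connected_component G H -> H <> Gs -> complete_bipartite H &
        [\/ complete_bipartite Gs, split_type Gs | is_K4 Gs]].
Proof.
move=> exG conG.
have colB H : two_connected_component G H -> colourable H -> complete_bipartite H.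
  move=> compH; have [_ twoH _] := compH.
  by apply: two_connected_complete_bipartite => //; apply: block_exchange compH.
have [[Gs [compGs odd_Gs]]|all_col] :=
    pselect (exists Gs, two_connected_component G Gs /\ ~ colourable Gs).
  exists Gs; split=> // [H compH HGs|].
    apply: colB => //; apply: contrapT => odd_H; apply: HGs.
    exact: (odd_blocks_eq exG conG).
  have exGs := block_exchange exG compGs; have [_ [conGs delGs] _] := compGs.
  have [x [p xp]] : exists x p, odd_closed_walk Gs x p.
    apply: contrapT => none; apply: odd_Gs.
    by apply: colourable_of_odd_closed_walk_free => // x p xp; apply: none; exists x, p.
  have [c [N soc]] := exists_shortest_odd_cycle xp.
  have cG i : c i \in vset Gs by apply: adj_vsetl (soc_adj soc i).
  have split_at i : ~ (exists x p, odd_closed_walk (delv Gs (c i)) x p) -> split_type Gs.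
    move=> none; apply: (@exchange_split_type _ (c i)) => // y q yq.
    by apply: none; exists y, q.
  have [odd0|/split_at] := pselect (exists x p, odd_closed_walk (delv Gs (c 0)) x p);
    last by constructor 2.
  have [odd1|/split_at] := pselect (exists x p, odd_closed_walk (delv Gs (c 1)) x p);
    last by constructor 2.
  constructor 3; have [K] := two_twins_clique4 exGs (conj conGs delGs) soc odd0 odd1.
  exact: clique4_is_K4.
have esetP0 : [forall e in (set0 : {set {set V}}), (e \subset (set0 : {set V})) && (#|e| == 2)].
  by apply/forall_inP => e; rewrite inE.
have [||Gs compGs _] := @exists_block _ G (SGraph esetP0).
- by rewrite /subgraph !sub0set.
- by split=> x; rewrite inE.
have all_bip H : two_connected_component G H -> complete_bipartite H.
  by move=> compH; apply: colB => //; apply: contrapT => ncol; apply: all_col; exists H.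
by exists Gs; split=> [||//]; [exact: compGs | move=> H /all_bip | constructor 1; apply: all_bip].
Qed.

End Classification.

(** * Gluing blocks *)

Section Gluing.
Variable V : finType.
Implicit Types (G H : sgraph V) (x y z v t : V) (W A : {set V}) (ms ns es : seq {set V}).

(** The situation at a cut vertex, or, with disjoint parts, in a disconnected
    graph. *)
Record separation G W1 W2 : Prop := Separation {
  sep_cover : W1 :|: W2 = vset G;
  sep_proper1 : W1 \proper vset G;
  sep_proper2 : W2 \proper vset G;
  sep_meet : {in W1 :&: W2 &, forall x y, x = y};
  sep_adj : forall x y, adj G x y ->
    (x \in W1) && (y \in W1) || (x \in W2) && (y \in W2) }.

Lemma separation_sym G W1 W2 : separation G W1 W2 -> separation G W2 W1.
Proof.
case=> cov p1 p2 meet adjW; split; rewrite 1?setUC 1?setIC // => x y /adjW.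
by rewrite orbC.
Qed.

(** A set A whose vertices have neighbours only in A and U is one side; the
    points of U, at most one, belong to both sides. *)
Lemma separation_of_disconnection G A (U : {set V}) x y :
  {in U &, forall a b, a = b} -> U \subset vset G -> [disjoint A & U] ->
  (forall a b, adj G a b -> a \in A -> b \in A :|: U) ->
  x \in A -> A \subset vset G -> y \in vset G -> y \notin A :|: U ->
  separation G (A :|: U) (vset G :\: A).
Proof.
move=> meetU UG disAU clA xA AG yG yAU; split.
- apply/setP => z; rewrite !inE; case zA : (z \in A) => //=.
    by rewrite (subsetP AG).
  by case zU : (z \in U) => //=; rewrite (subsetP UG).
- rewrite properE subUset AG UG; apply/negP => /subsetP/(_ _ yG); exact/negP.
- rewrite properE subsetDl; apply/negP => /subsetP/(_ x).
  by rewrite !inE xA (subsetP AG) // => /(_ isT).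
- by move=> a b; rewrite !inE => /andP[/orP[aA /andP[/negP//]|aU] _]
    /andP[/orP[bA /andP[/negP//]|bU] _]; apply: meetU.
move=> a b ab; have aG := adj_vsetl ab; have bG := adj_vsetr ab; rewrite !in_setD aG bG !andbT.
have [aA|aA] := boolP (a \in A).
  by rewrite (clA _ _ ab aA) inE aA.
have [bA|//] := boolP (b \in A); last by rewrite orbT.
by rewrite adj_sym in ab; rewrite (clA _ _ ab bA) !inE bA.
Qed.

Lemma not_two_connected_separation G : ~ two_connected G ->
  exists W1 W2, separation G W1 W2.
Proof.
have sep (H : sgraph V) (U : {set V}) : ~ connected H ->
    {in U &, forall a b, a = b} -> vset H = vset G :\: U -> U \subset vset G ->
    (forall a b, adj G a b -> a \in vset H -> b \in vset H -> adj H a b) ->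
    exists W1 W2, separation G W1 W2.
  move=> ncon meetU vH UG adjH.
  have [x [y [xH yH xy]]] :
      exists x y, [/\ x \in vset H, y \in vset H & ~~ connect (adj H) x y].
    apply: contrapT => none; apply: ncon => x y xH yH; apply/negPn/negP => xy.
    by apply: none; exists x, y.
  pose A := [set z in vset H | connect (adj H) x z].
  exists (A :|: U), (vset G :\: A); apply: (@separation_of_disconnection _ _ _ x y) => //.
  - by apply/pred0P => z /=; rewrite !inE vH !inE; case: (z \in U); rewrite ?andbF.
  - move=> a b ab; rewrite !inE => /andP[aH xa].
    have [//|bU] := boolP (b \in U); first by rewrite orbT.
    have bH : b \in vset H by rewrite vH !inE bU (adj_vsetr ab).
    by rewrite bH (connect_trans xa) // connect1 // adjH.
  - by rewrite !inE xH connect0.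
  - by apply/subsetP => z; rewrite !inE vH !inE => /andP[/andP[]].
  - by move: yH; rewrite vH !inE => /andP[].
  - by rewrite !inE (negbTE xy) andbF; move: yH; rewrite vH !inE => /andP[].
move=> ntwo; have [conG|ncon] := pselect (connected G); last first.
  by apply: (sep _ set0 ncon); rewrite ?setD0 ?sub0set // => a b; rewrite inE.
have [v [vG ndel]] : exists v, v \in vset G /\ ~ connected (delv G v).
  apply: contrapT => none; apply: ntwo; split=> // v vG.
  by apply: contrapT => ndel; apply: none; exists v.
apply: (sep _ [set v] ndel); rewrite ?vset_delv ?sub1set //.
- by move=> a b; rewrite !inE => /eqP-> /eqP.
by move=> a b ab; rewrite !inE adj_delv ab => /andP[-> _] /andP[->].
Qed.

(** Deleting the common vertex of the two sides would disconnect a subgraph that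
    reaches beyond it on both sides. *)
Lemma two_connected_in_side G H W1 W2 : separation G W1 W2 -> subgraph H G ->
  two_connected H -> vset H \subset W1 \/ vset H \subset W2.
Proof.
case=> cov _ _ meet adjW subH [conH delH].
have [|/subsetPn[b bH b1]] := boolP (vset H \subset W1); first by left.
have [|/subsetPn[a aH a2]] := boolP (vset H \subset W2); first by right.
exfalso; have HG := subsetP (proj1 (andP subH)).
have inW z : z \in vset H -> (z \in W1) || (z \in W2).
  by move=> /HG; rewrite -cov inE.
have a1 : a \in W1 by have := inW a aH; rewrite (negbTE a2) orbF.
have stay (e : rel V) : subrel e (adj G) ->
    (forall x y, e x y -> y \in W1 -> y \notin W2) -> connect e a b -> False.
  move=> sub_e off /connectP[p ap bE].
  suff : last a p \in W1 by rewrite -bE (negbTE b1).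
  elim: p a {aH a1 a2}(a1) (a2) ap {bE} => //= u p IH w w1 w2 /andP[wu up].
  have u1 : u \in W1.
    by have := adjW _ _ (sub_e _ _ wu); rewrite w1 (negbTE w2) /= orbF.
  by apply: IH => //; apply: off wu u1.
have [[v vH vI]|none] := pselect (exists2 v, v \in vset H & v \in W1 :&: W2).
  apply: (stay (adj (delv H v))).
  - by move=> x y; rewrite adj_delv => /and3P[/(adj_subgraph subH)].
  - move=> x y; rewrite adj_delv => /and3P[_ _ yv] y1; apply: contraNN yv => y2.
    by apply/eqP/meet; rewrite // inE y1.
  apply: delH => //; rewrite vset_delv !inE ?aH ?bH andbT.
    by apply: contraNneq a2 => ->; move: vI; rewrite inE => /andP[].
  by apply: contraNneq b1 => ->; move: vI; rewrite inE => /andP[].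
apply: (stay (adj H)); first exact: adj_subgraph.
  move=> x y /adj_vsetr yH y1; apply/negP => y2; apply: none.
  by exists y; rewrite // inE y1.
exact: conH.
Qed.

Lemma vset_induced_side G W1 W2 : separation G W1 W2 -> vset (induced G W1) = W1.
Proof. by case=> cov _ _ _ _; apply/setIidPr; rewrite -cov subsetUl. Qed.

(** The exception occurs when the common vertex is isolated in one of the sides:
    there it is a block, but not in the whole graph. *)
Lemma block_of_side G W1 W2 H : separation G W1 W2 ->
  two_connected_component (induced G W1) H ->
  two_connected_component G H \/ vset H \subset W1 :&: W2.
Proof.
move=> sep [sub1 twoH maxH]; have [/andP[vH1 eH1]] := sub1.
rewrite (vset_induced_side sep) in vH1.
have [|out] := boolP (vset H \subset W1 :&: W2); first by right.
left; split=> //.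
  case/andP: (sub_induced G W1) => sv se; apply/andP; split.
    by case/andP: sub1 => v1 _; apply: subset_trans v1 sv.
  exact: subset_trans eH1 se.
move=> H' subH' twoH' sub; apply: maxH => //.
have [in1|in2] := two_connected_in_side sep subH' twoH'; last first.
  case/negP: out; rewrite subsetI vH1; apply: subset_trans in2.
  by case/andP: sub.
case/andP: subH' => v' e'; rewrite /subgraph /= subsetI v' in1 /=.
apply/subsetP => e eH'; rewrite inE (subsetP e') //= subsetI.
by rewrite !(subset_trans (edge_sub eH')).
Qed.

Lemma two_connected_is_block G : two_connected G -> two_connected_component G G.
Proof.
move=> twoG; split=> // [|H /andP[v1 e1] _ /andP[v2 e2]]; first by rewrite /subgraph !subxx.
by apply: sgraph_eq; apply/eqP; rewrite eqEsubset ?v1 ?e1.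
Qed.

(** Flipping one colouring makes the two agree on the common vertex. *)
Lemma colourable_glue G W1 W2 : separation G W1 W2 ->
  colourable (induced G W1) -> colourable (induced G W2) -> colourable G.
Proof.
move=> sep [col1 colG1] [col2 colG2].
have [cov _ _ meet adjW] := sep.
have [col2' colG2' agree] : exists2 col2', colouring (induced G W2) col2' &
    {in W1 :&: W2, col1 =1 col2'}.
  have [I0|[v vI]] := set_0Vmem (W1 :&: W2).
    by exists col2 => // z; rewrite I0 inE.
  exists (fun z => col2 z (+) (col1 v (+) col2 v)) => [x y /colG2|z zI].
    by case: (col2 x); case: (col2 y); case: (col1 v); case: (col2 v).
  by rewrite (meet _ _ zI vI); case: (col1 v); case: (col2 v).
have col_on2 z : z \in W2 -> (if z \in W1 then col1 z else col2' z) = col2' z.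
  by move=> z2; case: ifP => // z1; apply: agree; rewrite inE z1.
exists (fun z => if z \in W1 then col1 z else col2' z) => x y xy.
have /orP[/andP[xW yW]|/andP[xW yW]] := adjW _ _ xy.
  by rewrite xW yW; apply: colG1; rewrite adj_induced xy xW.
by rewrite !col_on2 //; apply: colG2'; rewrite adj_induced xy xW.
Qed.

Lemma split_edge_list G G1 G2 ms : {subset eset G <= [predU eset G1 & eset G2]} ->
  {subset ms <= eset G} -> exists ms1 ms2, [/\ {subset ms1 <= eset G1},
    {subset ms2 <= eset G2} & forall x, edeg ms x = edeg ms1 x + edeg ms2 x].
Proof.
move=> cov; elim: ms => [_|e ms IH]; first by exists [::], [::].
move=> /edges_cons[eG /IH[ms1 [ms2 [sub1 sub2 deg]]]].
have /orP[e1|e2] := cov _ eG.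
  by exists (e :: ms1), ms2; split=> // [|x]; [apply/edges_cons|rewrite !edeg_cons deg addnA].
by exists ms1, (e :: ms2); split=> // [|x]; [apply/edges_cons|rewrite !edeg_cons deg addnCA].
Qed.

(** The edge monomials of the two graphs involve no relation between one graph
    and the other: the edge ring of the union is the tensor product of the
    two edge rings. *)
Definition independent_edges G1 G2 := forall as1 bs1 as2 bs2,
  {subset as1 <= eset G1} -> {subset bs1 <= eset G1} ->
  {subset as2 <= eset G2} -> {subset bs2 <= eset G2} ->
  (forall x : V, edeg as1 x + edeg as2 x = edeg bs1 x + edeg bs2 x) ->
  edeg as1 =1 edeg bs1 /\ edeg as2 =1 edeg bs2.

(** For edges e and f from different graphs, independence shows that e divides
    ms already; for edges of the same graph the other graph is a spectator. *)
Lemma exchange_union G G1 G2 : {subset eset G <= [predU eset G1 & eset G2]} ->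
  {subset eset G1 <= eset G} -> {subset eset G2 <= eset G} ->
  independent_edges G1 G2 -> exchange G1 -> exchange G2 -> exchange G.
Proof.
have core H1 H2 e f ms ns : {subset eset G <= [predU eset H1 & eset H2]} ->
    {subset eset H1 <= eset G} -> {subset eset H2 <= eset G} ->
    independent_edges H1 H2 -> exchange H1 -> e \in eset H1 -> f \in eset G -> e != f ->
    {subset ms <= eset G} -> {subset ns <= eset G} ->
    edeg (f :: ms) =1 edeg (e :: ns) ->
    exchangeable G e f ms.
  move=> cov up1 up2 indep ex1 e1 fG ef msG nsG deg_eq.
  have [ms1 [ms2 [ms1H ms2H dms]]] := split_edge_list cov msG.
  have [ns1 [ns2 [ns1H ns2H dns]]] := split_edge_list cov nsG.
  have up s1 s2 : {subset s1 <= eset H1} -> {subset s2 <= eset H2} ->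
      {subset s1 ++ s2 <= eset G}.
    by move=> s1H s2H; apply: edges_cat => a; [move/s1H/up1 | move/s2H/up2].
  have ens1 : {subset e :: ns1 <= eset H1} by apply/edges_cons.
  have /orP[f1|f2] := cov _ fG.
    have fms1 : {subset f :: ms1 <= eset H1} by apply/edges_cons.
    have [|deg1 deg2] := indep _ _ _ _ fms1 ens1 ms2H ns2H.
      by move=> x; have := deg_eq x; rewrite !edeg_cons dms dns !addnA.
    have [g [h [ms' [g1 h1 ms'H dms1 dgh]]]] := ex1 e f ms1 ns1 e1 f1 ef ms1H ns1H deg1.
    exists g, h, (ms' ++ ms2); split; rewrite ?up1 //; first exact: up.
    by move=> x; rewrite dms dms1 !edeg_cons edeg_cat addnA.
  have fms2 : {subset f :: ms2 <= eset H2} by apply/edges_cons.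
  have [|deg1 deg2] := indep _ _ _ _ ms1H ens1 fms2 ns2H.
    by move=> x; have := deg_eq x; rewrite !edeg_cons dms dns; clear; lia.
  exists e, f, (ns1 ++ ms2); split=> //; [exact: up1 | exact: up |].
  by move=> x; rewrite dms deg1 !edeg_cons edeg_cat addnA.
move=> cov up1 up2 indep ex1 ex2 e f ms ns eG fG ef msG nsG deg_eq.
have /orP[e1|e2] := cov _ eG; first exact: (core G1 G2 e f ms ns).
apply: (core G2 G1 e f ms ns) => //; first by move=> a /cov; rewrite !inE orbC.
move=> as1 bs1 as2 bs2 sa1 sb1 sa2 sb2 deg.
have deg' x : edeg as2 x + edeg as1 x = edeg bs2 x + edeg bs1 x by rewrite addnC deg addnC.
by have [] := indep _ _ _ _ sa2 sb2 sa1 sb1 deg'.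
Qed.

(** Away from the common vertex x the degrees come from one side only. On a
    2-coloured side the total degrees of the two parts agree, so the degree
    at x is determined as well. *)
Lemma separation_independent_edges G W1 W2 : separation G W1 W2 ->
  colourable (induced G W1) -> independent_edges (induced G W1) (induced G W2).
Proof.
move=> sep [col colG] as1 bs1 as2 bs2 sa1 sb1 sa2 sb2 deg.
have [cov _ _ meet adjW] := sep.
have off1 s x : {subset s <= eset (induced G W1)} -> x \notin W1 -> edeg s x = 0.
  move=> sub x1; apply/eqP; rewrite -leqn0 leqNgt; apply: contraNN x1.
  by move/(edeg_vset sub); rewrite (vset_induced_side sep).
have off2 s x : {subset s <= eset (induced G W2)} -> x \notin W2 -> edeg s x = 0.
  move=> sub x2; apply/eqP; rewrite -leqn0 leqNgt; apply: contraNN x2.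
  by move/(edeg_vset sub); rewrite (vset_induced_side (separation_sym sep)).
have eq_off x : x \notin W1 :&: W2 -> edeg as1 x = edeg bs1 x.
  rewrite inE negb_and => /orP[x1|x2]; first by rewrite (off1 _ _ sa1 x1) (off1 _ _ sb1 x1).
  by have := deg x; rewrite (off2 _ _ sa2 x2) (off2 _ _ sb2 x2) !addn0.
suff deg1 : edeg as1 =1 edeg bs1.
  by split=> // x; have := deg x; rewrite deg1 => /addnI.
move=> x; have [xI|/eq_off//] := boolP (x \in W1 :&: W2).
(* the colouring is normalized so that x lies in the part named [true] *)
pose col' z := col z == col x.
have colG' : colouring (induced G W1) col'.
  by move=> a b /colG; rewrite /col'; case: (col a); case: (col b); case: (col x).
have bal s : {subset s <= eset (induced G W1)} ->
    edeg s x + \sum_(z | col' z && (z != x)) edeg s z = \sum_(z | ~~ col' z) edeg s z.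
  by move=> /(colouring_sum colG') <-; rewrite [RHS](bigD1 x) // /col'.
have off_x z : z != x -> edeg as1 z = edeg bs1 z.
  by move=> zx; apply: eq_off; apply: contraNN zx => zI; apply/eqP/meet.
have := bal _ sa1; have := bal _ sb1.
rewrite (eq_bigr (edeg as1)) => [|z /andP[_ zx]]; last by rewrite off_x.
rewrite [X in _ = X](eq_bigr (edeg as1)) => [|z cz]; last first.
  by rewrite off_x //; apply: contraNneq cz => ->; rewrite /col'.
by move=> <- /addIn.
Qed.

Lemma exchange_glue G W1 W2 : separation G W1 W2 -> colourable (induced G W1) ->
  exchange (induced G W1) -> exchange (induced G W2) -> exchange G.
Proof.
move=> sep col1; have [cov _ _ _ adjW] := sep.
apply: exchange_union; last exact: separation_independent_edges.
- move=> e eG; have [x [y [_ eE xy]]] := edgeP eG.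
  rewrite inE eE; apply/orP.
  have /orP[/andP[xW yW]|/andP[xW yW]] := adjW _ _ xy; [left | right].
    by rewrite /= -[_ \in _]/(adj (induced G W1) x y) adj_induced xy xW.
  by rewrite /= -[_ \in _]/(adj (induced G W2) x y) adj_induced xy xW.
- by move=> e; rewrite inE => /andP[].
by move=> e; rewrite inE => /andP[].
Qed.

Lemma trivial_colourable H : {in vset H &, forall x y, x = y} -> colourable H.
Proof.
move=> triv; exists xpred0 => x y xy.
by have := adj_neq xy; rewrite (triv x y) ?eqxx ?(adj_vsetl xy) ?(adj_vsetr xy).
Qed.

Lemma trivial_exchange H : {in vset H &, forall x y, x = y} -> exchange H.
Proof.
move=> triv e f ms ns eH; have [x [y [xy _ adjxy]]] := edgeP eH.
by move: xy; rewrite (triv x y) ?eqxx ?(adj_vsetl adjxy) ?(adj_vsetr adjxy).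
Qed.

Lemma colourable_of_blocks G :
  (forall H, two_connected_component G H -> colourable H) -> colourable G.
Proof.
have [n] := ubnP #|vset G|; elim: n G => // n IH G ltn colB.
have [twoG|/not_two_connected_separation[W1 [W2 sep]]] := pselect (two_connected G).
  exact/colB/two_connected_is_block.
have side A B : separation G A B -> colourable (induced G A).
  move=> sepAB; apply: IH.
    rewrite (vset_induced_side sepAB).
    by apply: leq_trans (proper_card (sep_proper1 sepAB)) _.
  move=> H /(block_of_side sepAB)[/colB//|/subsetP triv].
  by apply: trivial_colourable => x y /triv xI /triv yI; apply: (sep_meet sepAB).
exact: colourable_glue sep (side _ _ sep) (side _ _ (separation_sym sep)).
Qed.

(** Induction on the number of vertices, cutting the graph into two sides. A
    non-bipartite block on each side would be two non-bipartite blocks of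
    the graph, so one side is bipartite. *)
Lemma exchange_of_blocks G :
  (forall H, two_connected_component G H -> exchange H) ->
  (forall H1 H2, two_connected_component G H1 -> two_connected_component G H2 ->
    H1 <> H2 -> colourable H1 \/ colourable H2) ->
  exchange G.
Proof.
have [n] := ubnP #|vset G|; elim: n G => // n IH G ltn exB colB.
have [twoG|/not_two_connected_separation[W1 [W2 sep]]] := pselect (two_connected G).
  exact/exB/two_connected_is_block.
have triv A B H : separation G A B -> vset H \subset A :&: B ->
    {in vset H &, forall x y, x = y}.
  by move=> sepAB /subsetP sub x y /sub xI /sub yI; apply: (sep_meet sepAB).
have side A B : separation G A B -> exchange (induced G A).
  move=> sepAB; apply: IH.
  - rewrite (vset_induced_side sepAB).
    by apply: leq_trans (proper_card (sep_proper1 sepAB)) _.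
  - move=> H /(block_of_side sepAB)[/exB//|/(triv _ _ _ sepAB)]; exact: trivial_exchange.
  move=> H1 H2 /(block_of_side sepAB)[comp1|/(triv _ _ _ sepAB)/trivial_colourable];
    last by left.
  by move=> /(block_of_side sepAB)[/(colB _ _ comp1)//|/(triv _ _ _ sepAB)/trivial_colourable];
    right.
have sep' := separation_sym sep.
have [col1|ncol1] := pselect (colourable (induced G W1)).
  exact: exchange_glue sep col1 (side _ _ sep) (side _ _ sep').
apply: (exchange_glue sep' _ (side _ _ sep') (side _ _ sep)).
apply: colourable_of_blocks => H2 comp2.
apply: contrapT => ncol2; apply: ncol1; apply: colourable_of_blocks => H1 comp1.
have [block2|/(triv _ _ _ sep')/trivial_colourable//] := block_of_side sep' comp2.
have [block1|/(triv _ _ _ sep)/trivial_colourable//] := block_of_side sep comp1.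
have [H12|H12] := pselect (H1 = H2); last by have [] := colB _ _ block1 block2 H12.
(* a common block of the two sides lies in their intersection *)
apply: trivial_colourable; apply: (triv _ _ _ sep); rewrite subsetI.
have [/andP[v1 _] _ _] := comp1; have [/andP[v2 _] _ _] := comp2.
by rewrite -{1}(vset_induced_side sep) v1 -(vset_induced_side sep') H12 v2.
Qed.

Lemma complete_bipartite_blocks_exchange G :
  (forall H, two_connected_component G H -> complete_bipartite H) -> exchange G.
Proof.
move=> cb; apply: exchange_of_blocks => [H /cb|H1 H2 /cb/complete_bipartite_colourable].
  exact: complete_bipartite_exchange.
by left.
Qed.

End Gluing.

Lemma split_type_exchange (V : finType) (G : sgraph V) : split_type G -> exchange G.
Proof.
move=> [v [V1 [V2 [[vG _] bip cb]]]].
apply: exchange_iso (edge_iso_sym (split_iso vG bip)) _.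
exact: complete_bipartite_blocks_exchange.
Qed.

Theorem exchange_iff_classification (V : finType) (G : sgraph V) : connected G ->
  exchange G <-> exists Gs : sgraph V,
    [/\ two_connected_component G Gs,
        forall H, two_connected_component G H -> H <> Gs -> complete_bipartite H &
        [\/ complete_bipartite Gs, split_type Gs | is_K4 Gs]].
Proof.
move=> conG; split=> [exG|[Gs [compGs cb Gs_type]]]; first exact: exchange_classification.
have exGs : exchange Gs.
  case: Gs_type; [exact: complete_bipartite_exchange | exact: split_type_exchange |
    exact: K4_exchange].
apply: exchange_of_blocks => [H compH|H1 H2 comp1 comp2 H12].
  have [->//|/(cb _ compH)] := pselect (H = Gs); exact: complete_bipartite_exchange.
have [H1Gs|/(cb _ comp1)/complete_bipartite_colourable] := pselect (H1 = Gs);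
  last by left.
right; apply: complete_bipartite_colourable; apply: cb => // H2Gs.
by apply: H12; rewrite H1Gs.
Qed.

(** * Edge rings *)

Import mpoly GRing.Theory.

Section EdgeMonomials.
Local Open Scope ring_scope.
Variables (K : fieldType) (n : nat) (G : sgraph 'I_n).
Implicit Types (es fs ms ns : seq {set 'I_n}) (m : 'X_{1..n}) (x y : edge_ring K G).

Definition edge_mnm es : 'X_{1..n} := [multinom edeg es i | i < n].

Lemma edge_mnmE es i : edge_mnm es i = edeg es i.
Proof. exact: mnmE. Qed.

Lemma edge_mnm_eq es fs : edge_mnm es = edge_mnm fs <-> edeg es =1 edeg fs.
Proof.
split=> [/mnmP eq_m i|eq_d]; first by have := eq_m i; rewrite !edge_mnmE.
by apply/mnmP => i; rewrite !edge_mnmE.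
Qed.

Lemma edge_mnm_cat es fs : edge_mnm (es ++ fs) = (edge_mnm es + edge_mnm fs)%MM.
Proof. by apply/mnmP => i; rewrite mnmDE !edge_mnmE edeg_cat. Qed.

Lemma edge_mnm_cons e es : edge_mnm (e :: es) = (edge_mnm [:: e] + edge_mnm es)%MM.
Proof. by rewrite -edge_mnm_cat. Qed.

Lemma edge_mnm_nil : edge_mnm [::] = 0%MM.
Proof. by apply/mnmP => i; rewrite !mnmE. Qed.

Lemma edge_mnm_nseq e k : edge_mnm (nseq k e) = (edge_mnm [:: e] *+ k)%MM.
Proof.
apply/mnmP => i; rewrite mulmnE !edge_mnmE /edeg /= addn0.
by elim: k => [|k IH]; rewrite ?muln0 //= IH mulnS.
Qed.

Lemma edge_mnm_eq0 es : {subset es <= eset G} -> edge_mnm es = 0%MM -> es = [::].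
Proof.
move=> esG /mnmP es0; have : size es = size ([::] : seq {set 'I_n}).
  by apply: (size_edeg esG) => // i; have := es0 i; rewrite edge_mnmE mnm0E.
by move/size0nil.
Qed.

Lemma tnth_edge_monomials k :
  tnth (edge_monomials K G) k = 'X_[edge_mnm [:: enum_val k]].
Proof.
rewrite tnth_mktuple mpolyXE_id big_mkcond /=; apply: eq_bigr => i _.
by rewrite edge_mnmE edeg_cons addn0; case: (i \in _).
Qed.

(** The exponents of the monomial count how often each edge is used. *)
Lemma comp_monomial (m : 'X_{1..#|eset G|}) : exists es, [/\ {subset es <= eset G},
  size es = mdeg m & 'X_[m] \mPo edge_monomials K G = 'X_[edge_mnm es]].
Proof.
rewrite comp_mpolyX mdegE.
elim/big_rec2: _ => [|k d p _ [es [esG <- ->]]].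
  by exists [::]; split; rewrite // edge_mnm_nil mpolyX0.
exists (nseq (m k) (enum_val k) ++ es); split.
- apply: edges_cat => // e; rewrite mem_nseq => /andP[_ /eqP->]; exact: enum_valP.
- by rewrite size_cat size_nseq.
by rewrite tnth_edge_monomials mpolyXn -mpolyXD edge_mnm_cat edge_mnm_nseq.
Qed.

Lemma comp_monomial_of es : {subset es <= eset G} ->
  exists2 q : {mpoly K[#|eset G|]}, q \is (size es).-homog &
    q \mPo edge_monomials K G = 'X_[edge_mnm es].
Proof.
elim: es => [_|e es IH].
  by exists 1; rewrite ?comp_mpoly1 ?edge_mnm_nil ?mpolyX0 // dhomog1.
move=> /edges_cons[eG /IH[q homq qE]].
exists ('X_(enum_rank_in eG e) * q).
  rewrite /= -[(size es).+1]add1n; apply: dhomogM homq.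
  by rewrite dhomogX /= mdeg1.
rewrite rmorphM /= qE comp_mpolyXU -tnth_nth tnth_edge_monomials enum_rankK_in //.
by rewrite -mpolyXD -edge_mnm_cons.
Qed.

Lemma msupp_comp (q : {mpoly K[#|eset G|]}) m :
  m \in msupp (q \mPo edge_monomials K G) ->
  exists (m' : 'X_{1..#|eset G|}) es,
    [/\ m' \in msupp q, {subset es <= eset G}, size es = mdeg m' & m = edge_mnm es].
Proof.
rewrite comp_mpolyEX => /msupp_sum_le/flatten_mapP[m'].
rewrite mem_filter /= => m'q /msuppZ_le.
have [es [esG sz ->]] := comp_monomial m'.
by move=> /mem_msuppXP <-; exists m', es.
Qed.

Lemma msupp_edge_ring x m : m \in msupp (val x) ->
  exists2 es, {subset es <= eset G} & m = edge_mnm es.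
Proof.
have /asboolP[q ->] := valP x.
by move=> /msupp_comp[m' [es [_ esG _ ->]]]; exists es.
Qed.

Definition edge_product es : edge_ring K G := insubd (0 : edge_ring K G) 'X_[edge_mnm es].

Lemma val_edge_product es : {subset es <= eset G} -> val (edge_product es) = 'X_[edge_mnm es].
Proof.
move=> /comp_monomial_of[q _ qE]; rewrite insubdK //.
by apply/asboolP; exists q.
Qed.

Lemma msupp_edge_product es m : {subset es <= eset G} ->
  m \in msupp (val (edge_product es)) -> m = edge_mnm es.
Proof. by move=> esG; rewrite val_edge_product // => /mem_msuppXP. Qed.

Lemma mem_msupp_edge_product es : {subset es <= eset G} ->
  edge_mnm es \in msupp (val (edge_product es)).
Proof. by move=> esG; rewrite val_edge_product //; apply/mem_msuppXP. Qed.

Lemma edge_ring_valM x y : val (x * y) = val x * val y.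
Proof. by []. Qed.

Lemma edge_ring_val_sum I (r : seq I) (P : pred I) (f : I -> edge_ring K G) :
  val (\sum_(i <- r | P i) f i) = \sum_(i <- r | P i) val (f i).
Proof. exact: raddf_sum. Qed.

Lemma edge_ringE x (f : 'X_{1..n} -> edge_ring K G) :
  (forall m, m \in msupp (val x) -> val (f m) = 'X_[m]) ->
  x = \sum_(m <- msupp (val x)) (val x)@_m *: f m.
Proof.
move=> fE; apply: val_inj; rewrite edge_ring_val_sum {1}[val x]mpolyE.
by apply: eq_big_seq => m /fE <-.
Qed.

Section Ideals.
Variables (t : nat) (u : 'I_t -> edge_ring K G) (A : {set 'I_t}).

Lemma ideal_gen_sum (I : eqType) (r : seq I) (c : I -> K) (f : I -> edge_ring K G) :
  {in r, forall i, ideal_gen u A (f i)} -> ideal_gen u A (\sum_(i <- r) c i *: f i).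
Proof.
elim: r => [_|i r IH fr].
  by exists (fun=> 0); rewrite big_nil big1 // => k _; rewrite mul0r.
have [|a aE] := IH; first by move=> j jr; apply: fr; rewrite inE jr orbT.
have [|b bE] := fr i; first by rewrite inE eqxx.
exists (fun k => c i *: b k + a k); rewrite big_cons aE bE scaler_sumr -big_split /=.
by apply: eq_bigr => k _; rewrite mulrDl scalerAl.
Qed.

(** The ring is spanned by monomials, and the monomials of a k * u k are those
    of a k multiplied by the monomial u k. *)
Lemma monomial_ideal (mu : 'I_t -> 'X_{1..n}) x :
  (forall k, val (u k) = 'X_[mu k]) ->
  ideal_gen u A x <-> (forall m, m \in msupp (val x) -> exists k es,
    [/\ k \in A, {subset es <= eset G} & m = (mu k + edge_mnm es)%MM]).
Proof.
move=> uE; split=> [[a ->] m|xP].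
  rewrite edge_ring_val_sum => /msupp_sum_le/flatten_mapP[k].
  rewrite mem_filter => /andP[kA _]; rewrite edge_ring_valM uE (perm_mem (msuppMX _ _)).
  by move=> /mapP[m' /msupp_edge_ring[es esG ->] ->]; exists k, es.
rewrite (@edge_ringE x (fun m => insubd 0 'X_[m])); last first.
  move=> m /msupp_edge_ring[es esG ->]; exact: val_edge_product.
apply: ideal_gen_sum => m /xP[k [es [kA esG ->]]].
exists (fun j => if j == k then edge_product es else 0).
rewrite (bigD1 k) //= eqxx big1 ?addr0 => [|j /andP[_ /negbTE->]]; last by rewrite mul0r.
apply: val_inj; rewrite edge_ring_valM uE val_edge_product // -mpolyXD.
rewrite insubdK; first by rewrite addmC.
have /asboolP[q qE] := valP (edge_product es * u k).
apply/asboolP; exists q; rewrite -qE.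
by rewrite edge_ring_valM uE val_edge_product // -mpolyXD addmC.
Qed.

End Ideals.

(** The homogeneous components of positive degree of a preimage of x sum up to x
    as soon as its constant term vanishes; the constant term of x is that of
    the preimage, since products of at least one edge are not constant. *)
Lemma irrelevantP x : irrelevant (@edge_grading K n G) x <->
  (forall m, m \in msupp (val x) -> m != 0%MM).
Proof.
have graded d (f : 'I_d -> edge_ring K G) m :
    (forall k : 'I_d, edge_grading k.+1 (f k)) -> m \in msupp (val (\sum_(k < d) f k)) ->
    m != 0%MM.
  move=> grf; rewrite edge_ring_val_sum => /msupp_sum_le/flatten_mapP[k _ /=].
  have [q homq ->] := grf k; move=> /msupp_comp[m' [es [m'q esG sz ->]]].
  apply/negP => /eqP/(edge_mnm_eq0 esG) es0.
  by have /dhomogP/(_ _ m'q) := homq; rewrite /= -sz es0.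
split=> [[d [f [grf ->]]] m|x0]; first exact: graded.
have /asboolP[q qE] := valP x.
have [q0|q_neq0] := eqVneq q 0.
  exists 0%N, (fun=> 0); split; first by case.
  by apply: val_inj; rewrite big_ord0 qE q0 comp_mpoly0 raddf0.
pose h k : {mpoly K[#|eset G|]} := pihomog [measure of mdeg] k q.
have hP k : h k \mPo edge_monomials K G \in edge_ring_pred G.
  by apply/asboolP; exists (h k).
pose f k : edge_ring K G := EdgeRing (hP k).
have grf k : edge_grading k (f k) by exists (h k); rewrite // pihomogP.
exists (msize q).-1, (fun k => f k.+1); split; first by move=> k; apply: grf.
have msq : (0 < msize q)%N by rewrite lt0n msize_poly_eq0.
have xE : x = f 0%N + \sum_(k < (msize q).-1) f k.+1.
  apply: val_inj; rewrite rmorphD /= edge_ring_val_sum qE.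
  rewrite {1}(@pihomog_partitionE _ _ [measure of mdeg] (msize q) q) //.
  by rewrite raddf_sum -(prednK msq) big_ord_recl.
suff f0 : f 0%N = 0 by rewrite {1}xE f0 add0r.
have f0_const m : m \in msupp (val (f 0%N)) -> m = 0%MM.
  move=> /msupp_comp[m' [es [m'h _ sz ->]]].
  have /dhomogP/(_ _ m'h) : h 0%N \is 0.-homog by exact: pihomogP.
  by rewrite /= -sz => /size0nil->; apply: edge_mnm_nil.
have coef0 y : (forall m, m \in msupp (val y) -> m != 0%MM) -> (val y)@_0%MM = 0.
  by move=> y0; apply: memN_msupp_eq0; apply/negP => /y0; rewrite eqxx.
have f00 : (val (f 0%N))@_0%MM = 0.
  have valx : val x = val (f 0%N) + val (\sum_(k < (msize q).-1) f k.+1).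
    by rewrite {1}xE.
  have := coef0 _ x0; rewrite valx mcoeffD (coef0 (\sum_(k < _) _)) ?addr0 // => m.
  by apply: graded => k; apply: grf.
apply: val_inj; apply/eqP; rewrite raddf0 -msupp_eq0.
case E : (msupp _) => [//|m s]; have mf : m \in msupp (val (f 0%N)) by rewrite E inE eqxx.
by move: (mf); rewrite (f0_const _ mf) mcoeff_msupp f00 eqxx.
Qed.

End EdgeMonomials.

Section StronglyKoszul.
Local Open Scope ring_scope.
Variables (K : fieldType) (n : nat) (G : sgraph 'I_n).
Implicit Types (es fs ms ns : seq {set 'I_n}) (m : 'X_{1..n}) (x y : edge_ring K G).

Lemma mul_monomial_ideal t (u : 'I_t -> edge_ring K G) (mu : 'I_t -> 'X_{1..n}) A x j :
  (forall k, val (u k) = 'X_[mu k]) ->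
  ideal_gen u A (x * u j) <-> (forall m, m \in msupp (val x) -> exists k es,
    [/\ k \in A, {subset es <= eset G} & mu j + m = mu k + edge_mnm es]%MM).
Proof.
move=> uE; rewrite (monomial_ideal _ _ uE) edge_ring_valM uE.
split=> H m.
  by move=> mx; apply: H; rewrite (perm_mem (msuppMX _ _)); apply: map_f.
by rewrite (perm_mem (msuppMX _ _)) => /mapP[m' /H[k [es [kA esG mE]]] ->]; exists k, es.
Qed.

(** The edges themselves are the generators. By [monomial_ideal], a colon ideal
    (e1, ..., er) : f is the sum of the colon ideals (ei) : f, and the
    exchange property provides generators of each of them among the edges. *)
Lemma exchange_strongly_koszul : exchange G -> edge_ring_strongly_koszul K G.
Proof.
move=> exG; pose u (k : 'I_#|eset G|) : edge_ring K G := edge_product K G [:: enum_val k].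
pose mu (k : 'I_#|eset G|) := edge_mnm [:: enum_val k].
have kG (k : 'I_#|eset G|) : {subset [:: enum_val k] <= eset G}.
  by apply/edges_cons; split; [apply: enum_valP |].
have uE k : val (u k) = 'X_[mu k] by apply: val_edge_product (kG k).
have index e : e \in eset G -> exists k : 'I_#|eset G|, enum_val k = e.
  by move=> eG; exists (enum_rank_in eG e); rewrite enum_rankK_in.
exists _, u; split; first by move=> k; exists (mu k).
split.
  split.
  - move=> k; exists 1%N; have [q homq qE] := comp_monomial_of K (kG k).
    by exists q; rewrite // uE qE.
  - move=> x; rewrite (monomial_ideal _ _ uE) irrelevantP; split=> xP m mx.
      have [k [es [_ esG ->]]] := xP _ mx; rewrite -edge_mnm_cons.
      apply/negP => /eqP/(edge_mnm_eq0 _)/= H; suff : [:: enum_val k & es] = [::] by [].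
      by apply: H; apply/edges_cons; split; first exact: enum_valP.
    have [[|e es] esG mE] := msupp_edge_ring mx.
      by have := xP _ mx; rewrite mE edge_mnm_nil eqxx.
    have [/index[k kE] es'G] := (edges_cons _ _ _).1 esG.
    by exists k, es; rewrite inE mE edge_mnm_cons /mu kE.
  move=> A AP; apply/setP => k; rewrite inE.
  have : ideal_gen u A (u k).
    apply/AP/irrelevantP => m; rewrite uE => /mem_msuppXP <-.
    by apply/negP => /eqP/(edge_mnm_eq0 (kG k)).
  move=> /(monomial_ideal _ _ uE)/(_ (mu k)); rewrite uE => H.
  have [|j [es [jA esG]]] := H; first exact/mem_msuppXP.
  rewrite -edge_mnm_cons => /edge_mnm_eq deg_eq.
  have esjG : {subset [:: enum_val j & es] <= eset G}.
    by apply/edges_cons; split; first exact: enum_valP.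
  have := size_edeg (kG k) esjG deg_eq; case: es deg_eq {esG esjG} => // deg_eq _.
  suff /enum_val_inj -> : enum_val k = enum_val j by [].
  by apply/setP => i; have := deg_eq i; rewrite !edeg_cons !addn0; do 2!case: (i \in _).
move=> r i homo_i j.
pose A : {set 'I_#|eset G|} := [set g : 'I_#|eset G| | `[< exists k : 'I_r, (k < j)%N /\
  exists h : 'I_#|eset G|, edeg [:: enum_val g; enum_val (i j)] =1 edeg [:: enum_val (i k); enum_val h] >]].
exists A => x; rewrite (mul_monomial_ideal _ _ _ uE) (monomial_ideal _ _ uE).
split=> xP m mx.
  have [ms msG mE] := msupp_edge_ring mx; have [_ [es [/imsetP[k kj ->] esG]]] := xP _ mx.
  rewrite inE in kj; rewrite mE -!edge_mnm_cons => /edge_mnm_eq deg_eq.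
  have [|g [h [ms' [/index[g' <-] /index[h' <-] ms'G dms dgh]]]] :=
    exG _ _ _ _ (enum_valP (i k)) (enum_valP (i j)) _ msG esG deg_eq.
    apply/eqP => /enum_val_inj ikj; have := homo_i _ _ kj.
    by rewrite ikj ltnn.
  exists g', ms'; split=> //; last by rewrite -edge_mnm_cons; apply/edge_mnm_eq.
  by rewrite inE; apply/asboolP; exists k; split=> //; exists h'.
have [g [es [gA esG mE]]] := xP _ mx.
move: gA; rewrite inE => /asboolP[k [kj [h dgh]]].
exists (i k), (enum_val h :: es); split.
- by apply/imsetP; exists k; rewrite ?inE.
- by apply/edges_cons; split; first exact: enum_valP.
rewrite mE -!edge_mnm_cons; apply/edge_mnm_eq => z.
have dgh_z := dgh z; rewrite !edeg_pair in dgh_z.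
by rewrite !edeg_cons addnCA addnA dgh_z addnA.
Qed.

(** Minimality forces the given monomial generators to be exactly the edges.
    Their order is arbitrary, so only one of (e) : f and (f) : e is
    accessible; an exchange for the pair (f, e) is one for (e, f) with the
    roles of g and h swapped. *)
Lemma strongly_koszul_exchange : edge_ring_strongly_koszul K G -> exchange G.
Proof.
move=> [t [u [u_mon [[_ gen min] colon]]]].
pose mu k := mlead (val (u k)).
have uE k : val (u k) = 'X_[mu k] by rewrite /mu; have [m ->] := u_mon k; rewrite mleadXm.
have mu_supp k : mu k \in msupp (val (u k)) by rewrite uE; apply/mem_msuppXP.
have gen_self (A : {set 'I_t}) k : k \in A -> ideal_gen u A (u k).
  move=> kA; apply/(monomial_ideal _ _ uE) => m; rewrite uE => /mem_msuppXP <-.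
  by exists k, [::]; split; rewrite // edge_mnm_nil addm0.
have mu_neq0 k : mu k != 0%MM.
  by have /gen/irrelevantP := gen_self setT k (in_setT _); apply.
have mu_edges k : exists es, [/\ {subset es <= eset G}, es != [::] & mu k = edge_mnm es].
  have [es esG muE] := msupp_edge_ring (mu_supp k); exists es; split=> //.
  by apply: contraNneq (mu_neq0 k) => es0; rewrite muE es0 edge_mnm_nil.
have one e : e \in eset G -> {subset [:: e] <= eset G} by move=> eG; apply/edges_cons.
have index e : e \in eset G -> exists k, mu k = edge_mnm [:: e].
  move=> eG; have : ideal_gen u setT (edge_product K G [:: e]).
    apply/gen/irrelevantP => m /(msupp_edge_product (one _ eG)) ->.
    by apply/negP => /eqP/(edge_mnm_eq0 (one _ eG)).
  move=> /(monomial_ideal _ _ uE)/(_ _ (mem_msupp_edge_product K (one _ eG))).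
  move=> [k [es [_ esG]]]; have [ks [ksG ks0 muE]] := mu_edges k; rewrite muE -edge_mnm_cat.
  move=> /edge_mnm_eq deg_eq; exists k; rewrite muE; apply/edge_mnm_eq => i.
  have := size_edeg (one _ eG) (edges_cat ksG esG) deg_eq; have := deg_eq i.
  by rewrite size_cat; case: ks ks0 {ksG muE deg_eq} => //= f [|f' ks] _; case: es {esG} => //=;
    rewrite ?addn0.
(* the generators that are edges already generate the irrelevant ideal *)
have only k : exists2 e, e \in eset G & mu k = edge_mnm [:: e].
  pose A0 := [set k | `[< exists2 e, e \in eset G & mu k = edge_mnm [:: e] >]].
  suff A0T : A0 = setT by have : k \in A0 by [rewrite A0T inE]; rewrite inE => /asboolP.
  apply: min => x; split=> [|/irrelevantP x0]; last first.
    apply/(monomial_ideal _ _ uE) => m mx.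
    have [[|e es] esG mE] := msupp_edge_ring mx.
      by have := x0 _ mx; rewrite mE edge_mnm_nil eqxx.
    have [eG es'G] := (edges_cons _ _ _).1 esG; have [j jE] := index _ eG.
    by exists j, es; rewrite mE edge_mnm_cons jE inE; split=> //; apply/asboolP; exists e.
  move=> /(monomial_ideal _ _ uE) xP; apply/gen/(monomial_ideal _ _ uE) => m.
  by move=> /xP[j [es [_ ? ?]]]; exists j, es; rewrite inE.
have key (ke kf : 'I_t) e f ms ns : (ke < kf)%N -> mu ke = edge_mnm [:: e] ->
    mu kf = edge_mnm [:: f] -> e \in eset G -> f \in eset G ->
    {subset ms <= eset G} -> {subset ns <= eset G} -> edeg (f :: ms) =1 edeg (e :: ns) ->
    exchangeable G e f ms.
  move=> lt_ef keE kfE eG fG msG nsG deg_eq.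
  pose i (k : 'I_2) := if k == ord0 then ke else kf.
  have [a b ab|A AP] := colon 2 i _ ord_max.
    by case: a b ab => [[|[|a]] pa] [[|[|b]] pb].
  have iE : [set i k | k : 'I_2 & (k < ord_max (n' := 1))%N] = [set ke].
    apply/setP => k; rewrite !inE; apply/imsetP/eqP => [[[[|a] pa]]|->].
    - by rewrite inE => _ ->.
    - by rewrite inE.
    by exists ord0; rewrite ?inE.
  rewrite iE in AP.
  have : ideal_gen u A (edge_product K G ms).
    apply/AP/(mul_monomial_ideal _ _ _ uE) => m /(msupp_edge_product msG) ->.
    exists ke, ns; rewrite inE eqxx; split=> //.
    rewrite keE [mu _]kfE -!edge_mnm_cons; exact/edge_mnm_eq.
  move=> /(monomial_ideal _ _ uE)/(_ _ (mem_msupp_edge_product K msG)).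
  move=> [a [ms' [aA ms'G]]]; have [g gG aE] := only a.
  rewrite aE -edge_mnm_cons => /edge_mnm_eq dms.
  have /AP/(mul_monomial_ideal _ _ _ uE)/(_ _ (mu_supp a)) := gen_self A a aA.
  move=> [ke' [hs [/set1P -> hsG]]].
  rewrite keE [mu _]kfE aE -!edge_mnm_cons => /edge_mnm_eq dgh.
  have fgG : {subset [:: f; g] <= eset G} by apply/edges_cons; split=> //; apply: one.
  have ehsG : {subset e :: hs <= eset G} by apply/edges_cons.
  have := size_edeg fgG ehsG dgh; case: hs hsG dgh {ehsG} => [|h [|]] // hsG dgh _.
  exists g, h, ms'; split=> //; first by apply: hsG; rewrite inE.
  by move=> z; rewrite -dgh !edeg_cons addnCA.
move=> e f ms ns eG fG ef msG nsG deg_eq.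
have [ke keE] := index _ eG; have [kf kfE] := index _ fG.
have : ke != kf.
  apply: contraNneq ef => kef; have /edge_mnm_eq deg_ef : edge_mnm [:: e] = edge_mnm [:: f].
    by rewrite -keE kef.
  apply/eqP/setP => i; have := deg_ef i.
  by rewrite !edeg_cons !addn0; do 2!case: (i \in _).
rewrite -val_eqE neq_ltn => /orP[lt|lt]; first exact: key lt keE kfE eG fG msG nsG deg_eq.
have [h [g [ns' [hG gG ns'G dns dgh]]]] :=
  key kf ke f e ns ms lt kfE keE fG eG nsG msG (fun z => esym (deg_eq z)).
exists g, h, ns'; split=> // z; have dgh_z := dgh z; rewrite !edeg_pair in dgh_z.
  have := deg_eq z; rewrite !edeg_cons dns edeg_cons addnA [(_ + (z \in h))%N]addnC dgh_z.
  by rewrite -addnA => /addnI.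
by rewrite !edeg_pair addnC -dgh_z addnC.
Qed.

End StronglyKoszul.

Theorem theorem2p8 (K : fieldType) (n : nat) (G : sgraph 'I_n)
    (vsetG : vset G = [set: 'I_n]) (connG : connected G) :
  edge_ring_strongly_koszul K G <->
  exists Gs : sgraph 'I_n,
    [/\ two_connected_component G Gs,
        forall H : sgraph 'I_n,
          two_connected_component G H -> H <> Gs -> complete_bipartite H &
        [\/ complete_bipartite Gs, split_type Gs | is_K4 Gs]].
Proof.
apply: iff_trans (exchange_iff_classification connG).
by split; [exact: strongly_koszul_exchange | exact: exchange_strongly_koszul].
Qed.
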